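(* For $s_1,s_3\in\mathbb{C}$, as an identity of meromorphic functions on $\mathbb{C}^2$, \begin{align*} &\zeta_3(s_1,1,s_3,1,1,1;A_3)-\zeta_3(1,1,1,s_1,s_3,1;A_3)+\zeta_3(1,s_3,1,1,1,s_1;A_3)\\ &\quad+\zeta_3(s_3,1,s_1,1,1,1;A_3)-\zeta_3(1,1,1,s_3,s_1,1;A_3)+\zeta_3(1,s_1,1,1,1,s_3;A_3)\\ &=2\Bigl\{\zeta_2(s_1+2,s_3+1,1;A_2)+\zeta_2(s_1+2,1,s_3+1;A_2)-\zeta_2(s_3+1,1,s_1+2;A_2)\\ &\qquad-\zeta_2(s_1+1,1,s_3+2;A_2)+\zeta_2(s_3+2,1,s_1+1;A_2)+\zeta_2(s_1+1,s_3+2,1;A_2)\\ &\qquad-\zeta_2(s_1+1,2,s_3+1;A_2)-\zeta_2(s_3+1,2,s_1+1;A_2)+\zeta_2(s_1+1,s_3+1,2;A_2)\Bigr\}\\ &\quad+\zeta(s_1+s_3+4)-\frac{\pi^2}{3}\zeta(s_1+s_3+2). \end{align*}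
   Context: Here $\zeta$ is the Riemann zeta-function, $$\zeta_2(s_1,s_2,s_3;A_2)=\sum_{m_1,m_2=1}^\infty\frac{1}{m_1^{s_1}m_2^{s_2}(m_1+m_2)^{s_3}},$$ $$\zeta_3(s_1,s_2,s_3,s_4,s_5,s_6;A_3)=\sum_{m_1,m_2,m_3=1}^\infty\frac{1}{m_1^{s_1}m_2^{s_2}m_3^{s_3}(m_1+m_2)^{s_4}(m_2+m_3)^{s_5}(m_1+m_2+m_3)^{s_6}}.$$ These series converge absolutely when all $\Re s_i\ge1$, and the functions are continued meromorphically to $\mathbb{C}^3$ and $\mathbb{C}^6$ respectively. *)

(* Defs.v *)
From HB Require Import structures.
From mathcomp Require Import all_boot all_order all_algebra.
From mathcomp Require Import complex.
From mathcomp Require Import all_classical all_reals all_analysis.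
From mathcomp.analysis.showcase Require summability.

Set Implicit Arguments.
Unset Strict Implicit.
Unset Printing Implicit Defensive.

Import Order.TTheory GRing.Theory Num.Theory.
Import numFieldNormedType.Exports.

Local Open Scope classical_set_scope.
Local Open Scope ring_scope.
Local Open Scope complex_scope.

Section Defs.
Variable R : realType.
(* The regular module R[i]^o carries the topology and the norm of R[i]. *)
Local Notation C := R[i]^o.

Definition cexp (z : C) : C :=
  (expR (complex.Re z))%:C * (cos (complex.Im z) +i* sin (complex.Im z)).

(* m ^ s with the real logarithm of m; only used for m >= 1 *)
Definition natpow (m : nat) (s : C) : C := cexp (s * (ln (m%:R : R))%:C).

(* The general terms of the series. The indices run over nat, so the summation
   variables of the formulas are m1 = m.+1, etc. *)

Definition zeta_term (s : 'rV[C]_1) (m : nat) : C :=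
  (natpow m.+1 (s 0 0))^-1.

Definition zeta2_term (s : 'rV[C]_3) (m : nat * nat) : C :=
  let m1 := m.1.+1 in let m2 := m.2.+1 in
  (natpow m1 (s 0 0) * natpow m2 (s 0 1) * natpow (m1 + m2) (s 0 2))^-1.

Definition zeta3_term (s : 'rV[C]_6) (m : nat * nat * nat) : C :=
  let m1 := m.1.1.+1 in let m2 := m.1.2.+1 in let m3 := m.2.+1 in
  (natpow m1 (s 0 0) * natpow m2 (s 0 1) * natpow m3 (s 0 2)
   * natpow (m1 + m2) (s 0 3) * natpow (m2 + m3) (s 0 4)
   * natpow (m1 + m2 + m3) (s 0 5))^-1.

(* The family u is summable with sum l, independently of the order of summation
   (convergence of the partial sums along the finite subsets of I, which for
   complex families is the same as absolute convergence). *)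
Definition has_sum (I : choiceType) (u : I -> C) (l : C) : Prop :=
  summability.partial_sum u @ summability.totally --> l.

(* Complex differentiability: the scalars of 'rV[C]_n and C are R[i]. *)
Definition holomorphic n (U : set 'rV[C]_n) (f : 'rV[C]_n -> C) : Prop :=
  forall z, U z -> differentiable f z.

(* A function on C^n defined off a set [polar]; the values of [mero_val] on [polar]
   are irrelevant. *)
Record merofun n := MeroFun { polar : set 'rV[C]_n; mero_val : 'rV[C]_n -> C }.

(* f is meromorphic on C^n: [polar f] is a nowhere dense analytic hypersurface
   and f is locally a quotient g / h with [polar f] the zero set of h. The
   hypersurface is allowed to be larger than the set of poles. *)
Definition meromorphic n (f : merofun n) : Prop :=
  dense (~` polar f) /\
  forall a : 'rV[C]_n, exists (U : set 'rV[C]_n) (g h : 'rV[C]_n -> C),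
    [/\ open_nbhs a U, holomorphic U g, holomorphic U h &
      forall z, U z ->
        (polar f z <-> h z = 0) /\ (~ polar f z -> mero_val f z = g z / h z)].

(* f is a meromorphic continuation to C^n of the sum of the series with general
   term [u s], which converges for s in D. *)
Definition continues n (I : choiceType) (D : set 'rV[C]_n)
    (u : 'rV[C]_n -> I -> C) (f : merofun n) : Prop :=
  meromorphic f /\
  forall s, D s -> ~ polar f s /\ has_sum (u s) (mero_val f s).

Definition is_zeta (f : merofun 1) : Prop :=
  continues [set s | 1 < complex.Re (s 0 0)] zeta_term f.

Definition is_zeta2 (f : merofun 3) : Prop :=
  continues [set s | forall i, 1 <= complex.Re (s 0 i)] zeta2_term f.

Definition is_zeta3 (f : merofun 6) : Prop :=
  continues [set s | forall i, 1 <= complex.Re (s 0 i)] zeta3_term f.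

(* Operations on meromorphic functions; the polar set of the result is the set
   of points where some operand is undefined. *)

Definition mero_add n (f g : merofun n) : merofun n :=
  MeroFun (polar f `|` polar g) (fun z => mero_val f z + mero_val g z).

Definition mero_sub n (f g : merofun n) : merofun n :=
  MeroFun (polar f `|` polar g) (fun z => mero_val f z - mero_val g z).

Definition mero_scale n (c : C) (f : merofun n) : merofun n :=
  MeroFun (polar f) (fun z => c * mero_val f z).

(* The function w |-> f (t_0 w, ..., t_(n-1) w) on C^m. *)
Definition mero_subst n m (f : merofun n) (t : n.-tuple ('rV[C]_m -> C)) : merofun m :=
  let phi w := \row_(i < n) tnth t i w in
  MeroFun (phi @^-1` polar f) (mero_val f \o phi).

(* f and g are meromorphic functions on C^n and they are equal as such. *)
Definition mero_eq n (f g : merofun n) : Prop :=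
  [/\ meromorphic f, meromorphic g &
    forall z, ~ polar f z -> ~ polar g z -> mero_val f z = mero_val g z].

Definition coordC n (i : 'I_n) : 'rV[C]_n -> C := fun w => w 0 i.

End Defs.

Arguments coordC {R n} i.

Declare Scope merofun_scope.
Delimit Scope merofun_scope with mf.
Bind Scope merofun_scope with merofun.

Notation "f + g" := (mero_add f g) : merofun_scope.
Notation "f - g" := (mero_sub f g) : merofun_scope.
Notation "c *: f" := (mero_scale c%R f) : merofun_scope.
Notation "f =m g" := (mero_eq f g) (at level 70, no associativity) : merofun_scope.
Notation "f .( t1 , .. , tn )" :=
  (mero_subst f (@cons_tuple _ (_ -> _) t1%R ..
    (@cons_tuple _ (_ -> _) tn%R (nil_tuple (_ -> _))) ..))
  (at level 1, left associativity, format "f .( t1 ,  .. ,  tn )") : merofun_scope.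

(* Main.v *)
Require Import Defs.
From HB Require Import structures.
From mathcomp Require Import all_boot all_order all_algebra.
From mathcomp Require Import complex.
From mathcomp Require Import all_classical all_reals all_analysis.
From mathcomp Require Import finmap ring lra zify.
From mathcomp.analysis.showcase Require summability.

Set Implicit Arguments.
Unset Strict Implicit.
Unset Printing Implicit Defensive.

Import Order.TTheory GRing.Theory Num.Theory.
Import numFieldNormedType.Exports.

Local Open Scope classical_set_scope.
Local Open Scope ring_scope.

(** Where Re s1 and Re s3 are at least 1, every series in the relation converges, and by
    regrouping its terms it becomes a double Dirichlet series, the sum of
    a(p, q) p^(- s1) q^(- s3) over positive integers p and q (lemmas [zeta3_series],
    [zeta3_inner], [zeta3_gap], [zeta2_sum], [zeta2_lt], [zeta_diag]). The signed sum of
    the six coefficients on the left-hand side is the sum of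
    1 / (m (m + p) (m + q) (m + p + q)) over all integers m that are not poles: the series
    zeta_3(s1, 1, s3, 1, 1, 1) and its mirror image give the m outside the interval from
    - p - q to 0, and the other types give the m between consecutive poles. By partial
    fractions such a sum is a rational function of p and q when p and q differ, because a
    simple pole at a contributes its residue times minus the sum of 1 / (b - a) over the
    other poles b. When p = q there is a double pole, and the value zeta(2) = pi^2 / 6
    appears; this is the source of the term with pi^2 / 3. The comparison with the
    coefficients of the right-hand side is [coef_identity], and [value_identity] is the
    resulting equality of sums.

    The relation then extends to all of C^2 by the identity principle. The polar set of a
    meromorphic function, and the union of this set with the zeros, are locally zero sets
    of holomorphic functions, and such a set is the whole space as soon as it has an
    interior point ([analytic_set_full]). This also shows that the substitutions of affine
    functions are meromorphic: their polar sets are nowhere dense because they miss a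
    point of the region of convergence.

    A holomorphic function is only assumed to be complex differentiable at each point, so
    the identity principle starts from the theorem of Goursat, in the form that a closed
    differentiable 1-form on a rectangle has a primitive ([primitive_exists]). The
    primitive F of a holomorphic function has second derivatives, hence its squared
    modulus times exp (m Re phi), with phi holomorphic, satisfies the weak maximum
    principle. With phi (z) = exp (- k z) on a thin rectangle whose left side lies in the
    zero set of F, letting m tend to infinity gives F = 0 on the axis of the rectangle
    ([zero_on_axis]). *)

(** * The theorem of Goursat and primitives of closed forms *)

Section Goursat.
Variable R : realType.

Lemma antiderivative_exists (f : R -> R) (a b : R) : a < b ->
  (forall x, a <= x <= b -> {for x, continuous f}) ->
  exists F : R -> R, forall x, a < x < b -> is_derive x 1 F (f x).
Proof.
move=> ab cf.
exists (fun x => \int[lebesgue_measure]_(t in [set` `[a, x]]) (f t))%R.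
move=> x /andP[ax xb].
have fi : lebesgue_measure.-integrable `[a, b] (EFin \o f).
  apply: continuous_compact_integrable; first exact: segment_compact.
  apply: continuous_in_subspaceT => y; rewrite mem_setE in_itv => yab.
  exact: cf.
have [] := continuous_FTC1_closed xb fi ax; first by apply: cf; rewrite !ltW.
by rewrite derive1E => dF DF; rewrite -DF; exact: derivableP.
Qed.

Lemma is_derive_continuous (f : R -> R) (x df : R) : is_derive x 1 f df ->
  {for x, continuous f}.
Proof. by case=> /derivable1_diffP /differentiable_continuous. Qed.

Lemma mean_value (F f : R -> R) (a b : R) : a <= b ->
  (forall t, a <= t <= b -> is_derive t 1 F (f t)) ->
  exists2 t, a <= t <= b & F b - F a = f t * (b - a).
Proof.
move=> ab dF.
have dF' t : t \in `]a, b[%R -> is_derive t 1 F (f t).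
  by rewrite in_itv/= => /andP[at' tb]; apply: dF; rewrite !ltW.
have cF : {within `[a, b], continuous F}.
  apply: continuous_in_subspaceT => y; rewrite mem_setE in_itv => yab.
  exact: is_derive_continuous (dF _ yab).
have [t] := MVT_segment ab dF' cF.
by rewrite in_itv/= => ? ?; exists t.
Qed.

(** The mean value theorem for F minus the primitive of an affine approximation of
    its derivative. *)
Lemma increment_approx (F f : R -> R) (a b k p x0 e : R) : a <= b ->
  (forall t, a <= t <= b -> is_derive t 1 F (f t)) ->
  (forall t, a <= t <= b -> `|f t - k - p * (t - x0)| <= e) ->
  `|F b - F a - k * (b - a) - p * ((b - x0) ^+ 2 - (a - x0) ^+ 2) / 2|
    <= e * (b - a).
Proof.
move=> ab dF fe.
pose h t := F t - k * t - p * (t - x0) ^+ 2 / 2.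
have dh t : a <= t <= b -> is_derive t 1 h (f t - k - p * (t - x0)).
  move=> /dF dFt.
  rewrite /h; apply: is_derive_eq.
  by rewrite /GRing.scale/=; field.
have [t tab E] := mean_value ab dh.
have -> : F b - F a - k * (b - a) - p * ((b - x0) ^+ 2 - (a - x0) ^+ 2) / 2
   = h b - h a by rewrite /h; field.
rewrite E normrM (ger0_norm (_ : 0 <= b - a)) ?subr_ge0//.
by apply: ler_wpM2r; [rewrite subr_ge0|apply: fe].
Qed.

Lemma nested_intervals (a b : nat -> R) :
  (forall n, a n <= a n.+1) -> (forall n, b n.+1 <= b n) ->
  (forall n, a n <= b n) -> exists x, forall n, a n <= x <= b n.
Proof.
move=> ai bd ab.
have ai' : {homo a : m n / (m <= n)%N >-> m <= n}
  by apply: (homo_leq _ _ ai) => // y x z; exact: le_trans.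
have bd' : {homo b : m n / (m <= n)%N >-> n <= m}.
  by apply: (homo_leq _ _ bd) => // y x z yx zy; exact: le_trans zy yx.
have amb m n : a m <= b n.
  apply: (le_trans (ai' m (maxn m n) (leq_maxl _ _))).
  exact: (le_trans (ab _) (bd' n (maxn m n) (leq_maxr _ _))).
have hs : has_sup (range a).
  by split; [exists (a 0); exists 0|exists (b 0) => _ [m _ <-]].
exists (sup (range a)) => n; apply/andP; split.
  by apply: (sup_upper_bound hs); exists n.
by apply: ge_sup; [case: hs|move=> _ [m _ <-]].
Qed.

(** Fréchet differentiability at the single point [(x0, y0)], with the partial
    derivatives [p] and [q]; no regularity of the derivative is involved. *)
Definition fdiff (P : R -> R -> R) (x0 y0 p q : R) : Prop :=
  forall e, 0 < e -> exists2 d, 0 < d & forall x y,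
    `|x - x0| < d -> `|y - y0| < d ->
    `|P x y - P x0 y0 - p * (x - x0) - q * (y - y0)|
      <= e * (`|x - x0| + `|y - y0|).

(** For [G = B - A], where A is a primitive of P on horizontal lines and B one of Q on
    vertical lines, this is the integral of P dx + Q dy around the rectangle. *)
Definition mixed_diff (G : R -> R -> R) (x1 x2 y1 y2 : R) : R :=
  G x2 y2 - G x2 y1 - G x1 y2 + G x1 y1.

Lemma dist_lt_itv (l m t t0 w e : R) : l <= t <= m -> l <= t0 <= m -> 0 <= w ->
  m - l + w < e -> `|t - t0| < e.
Proof.
by move=> /andP[? ?] /andP[? ?] ? ?; rewrite ltr_norml; apply/andP; split; lra.
Qed.

Section Quarters.
Variables (G : R -> R -> R) (e : R).
Local Notation rect := (R * R * R * R)%type.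

Let bad (r : rect) := let: (x1, x2, y1, y2) := r in
  e * (x2 - x1 + (y2 - y1)) ^+ 2 < `|mixed_diff G x1 x2 y1 y2|.

Let quarter (r : rect) : rect := let: (x1, x2, y1, y2) := r in
  let mx := (x1 + x2) / 2 in let my := (y1 + y2) / 2 in
  if bad (x1, mx, y1, my) then (x1, mx, y1, my) else
  if bad (x1, mx, my, y2) then (x1, mx, my, y2) else
  if bad (mx, x2, y1, my) then (mx, x2, y1, my) else (mx, x2, my, y2).

Let bad_quarter r : bad r -> bad (quarter r).
Proof.
case: r => [[[x1 x2] y1] y2]; rewrite /quarter.
set mx := (x1 + x2) / 2; set my := (y1 + y2) / 2.
do 3![case: ifPn => //]; rewrite /bad -!leNgt /mixed_diff => B3 B2 B1 B0.
rewrite ltNge; apply/negP => B4; move: B0; apply/negP; rewrite -leNgt.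
have -> : G x2 y2 - G x2 y1 - G x1 y2 + G x1 y1 =
  (G x2 y2 - G x2 my - G mx y2 + G mx my) + (G x2 my - G x2 y1 - G mx my + G mx y1)
  + (G mx y2 - G mx my - G x1 y2 + G x1 my) + (G mx my - G mx y1 - G x1 my + G x1 y1)
  by ring.
have -> : e * (x2 - x1 + (y2 - y1)) ^+ 2 =
  e * (x2 - mx + (y2 - my)) ^+ 2 + e * (x2 - mx + (my - y1)) ^+ 2
  + e * (mx - x1 + (y2 - my)) ^+ 2 + e * (mx - x1 + (my - y1)) ^+ 2
  by rewrite /mx /my; field.
by do 3![apply: (le_trans (ler_normD _ _)); apply: lerD => //].
Qed.

(** Halving the sides divides the bound by four and the mixed difference is additive, so
    one of the four quarters is as bad as the whole; the successive quarters shrink to a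
    point. *)
Lemma bisection x1 x2 y1 y2 : x1 <= x2 -> y1 <= y2 ->
  e * (x2 - x1 + (y2 - y1)) ^+ 2 < `|mixed_diff G x1 x2 y1 y2| ->
  exists x0 y0, forall d, 0 < d -> exists a b a' b',
    [/\ [/\ x1 <= a, a <= x0, x0 <= b & b <= x2],
        [/\ y1 <= a', a' <= y0, y0 <= b' & b' <= y2],
        b - a + (b' - a') < d &
        e * (b - a + (b' - a')) ^+ 2 < `|mixed_diff G a b a' b'|].
Proof.
move=> x12 y12 bad0.
pose q n := iter n quarter (x1, x2, y1, y2).
pose a n := (q n).1.1.1; pose b n := (q n).1.1.2.
pose a' n := (q n).1.2; pose b' n := (q n).2.
have qE n : q n = (a n, b n, a' n, b' n).
  by rewrite /a /b /a' /b'; case: (q n) => [[[]]].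
have badn n : bad (q n) by elim: n => [//|n IH]; apply: bad_quarter.
have step n : quarter (a n, b n, a' n, b' n) = (a n.+1, b n.+1, a' n.+1, b' n.+1).
  by rewrite -!qE.
have next n : a n <= b n -> a' n <= b' n -> [/\ a n.+1 <= b n.+1, a' n.+1 <= b' n.+1
    & b n.+1 - a n.+1 + (b' n.+1 - a' n.+1) = (b n - a n + (b' n - a' n)) / 2] /\
   [/\ a n <= a n.+1, b n.+1 <= b n, a' n <= a' n.+1 & b' n.+1 <= b' n].
  move: (step n); rewrite /quarter; move: (a n) (b n) (a' n) (b' n) => l m l' m' st lm lm'.
  move: st; case: ifP => _; [|case: ifP => _; [|case: ifP => _]];
    case=> <- <- <- <-; clear -lm lm'; split; split; try lra; field.
have base n : [/\ a n <= b n, a' n <= b' n & b n - a n + (b' n - a' n) =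
    (x2 - x1 + (y2 - y1)) / 2 ^+ n].
  elim: n => [|n [h1 h2 h3]]; first by split => //; rewrite expr0 divr1.
  have [[k1 k2 ->] _] := next n h1 h2.
  by split => //; rewrite h3 exprSr invfM mulrA.
have H n : [/\ a n <= b n, a' n <= b' n & b n - a n + (b' n - a' n) =
    (x2 - x1 + (y2 - y1)) / 2 ^+ n] /\
   [/\ a n <= a n.+1, b n.+1 <= b n, a' n <= a' n.+1 & b' n.+1 <= b' n].
  by have [h1 h2 _] := base n; split; [exact: base|exact: (next n h1 h2).2].
have [x0 Hx0] := @nested_intervals a b (fun n => let: conj _ (And4 h _ _ _) := H n in h)
  (fun n => let: conj _ (And4 _ h _ _) := H n in h)
  (fun n => let: conj (And3 h _ _) _ := H n in h).
have [y0 Hy0] := @nested_intervals a' b'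
  (fun n => let: conj _ (And4 _ _ h _) := H n in h)
  (fun n => let: conj _ (And4 _ _ _ h) := H n in h)
  (fun n => let: conj (And3 _ h _) _ := H n in h).
exists x0, y0 => d d0.
have mono (f : nat -> R) : (forall n, f n <= f n.+1) -> forall n, f 0 <= f n.
  by move=> hf; elim=> // n IH; exact: le_trans IH (hf n).
have moni (f : nat -> R) : (forall n, f n.+1 <= f n) -> forall n, f n <= f 0.
  by move=> hf; elim=> // n IH; exact: le_trans (hf n) IH.
have [n Hn] : exists n, (x2 - x1 + (y2 - y1)) / 2 ^+ n < d.
  pose s := x2 - x1 + (y2 - y1).
  have s0 : 0 <= s by rewrite /s; lra.
  exists (Num.truncn (s / d)).+1.
  rewrite -/s ltr_pdivrMr ?exprn_gt0// mulrC -ltr_pdivrMr//.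
  apply: (lt_le_trans (truncnS_gt _)).
  by rewrite -natrX ler_nat ltnW// ltn_expl.
exists (a n), (b n), (a' n), (b' n); case: (H n) => -[h1 h2 h3] _.
have /andP[? ?] := Hx0 n; have /andP[? ?] := Hy0 n.
split => //.
- split => //; first by apply: (mono a) => m; case: (H m) => _ [].
  by apply: (moni b) => m; case: (H m) => _ [].
- split => //; first by apply: (mono a') => m; case: (H m) => _ [].
  by apply: (moni b') => m; case: (H m) => _ [].
- by rewrite h3.
- by have := badn n; rewrite qE.
Qed.

End Quarters.

Lemma fdiff_cts (P : R -> R -> R) x0 y0 p q : fdiff P x0 y0 p q ->
  forall e, 0 < e -> exists2 d, 0 < d & forall x y,
    `|x - x0| < d -> `|y - y0| < d -> `|P x y - P x0 y0| < e.
Proof.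
move=> dP e e0; have [d d0 Hd] := dP 1 ltr01.
pose m := 2 + `|p| + `|q|.
have m0 : 0 < m by rewrite /m -addrA ltr_wpDr ?addr_ge0.
exists (Num.min d (e / (2 * m))).
  by rewrite lt_min d0 divr_gt0// mulr_gt0.
move=> x y; rewrite !lt_min => /andP[xd xe] /andP[yd ye].
have := Hd x y xd yd; rewrite mul1r => H.
have xe' : `|x - x0| * m < e / 2.
  by rewrite -ltr_pdivlMr// -mulrA -invfM.
have ye' : `|y - y0| * m < e / 2.
  by rewrite -ltr_pdivlMr// -mulrA -invfM.
have -> : P x y - P x0 y0 = (P x y - P x0 y0 - p * (x - x0) - q * (y - y0))
  + (p * (x - x0) + q * (y - y0)) by ring.
apply: (le_lt_trans (ler_normD _ _)).
apply: (le_lt_trans (lerD H (ler_normD _ _))); rewrite !normrM.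
have h1 := normr_ge0 (x - x0); have h2 := normr_ge0 (y - y0).
have h3 := normr_ge0 p; have h4 := normr_ge0 q.
move: xe' ye'; rewrite /m; nra.
Qed.

Lemma fdiff_ctsx (P : R -> R -> R) x0 y0 p q : fdiff P x0 y0 p q ->
  {for x0, continuous (fun x => P x y0)}.
Proof.
move=> /fdiff_cts dP; apply/cvgrPdist_lt => /= e /dP[d d0 Hd].
near=> x; rewrite distrC; apply: Hd; last by rewrite subrr normr0.
by rewrite distrC; near: x; exact: (@cvgr_dist_lt _ _ _ _ _ id).
Unshelve. all: by end_near. Qed.

Lemma fdiff_ctsy (P : R -> R -> R) x0 y0 p q : fdiff P x0 y0 p q ->
  {for y0, continuous (fun y => P x0 y)}.
Proof.
move=> /fdiff_cts dP; apply/cvgrPdist_lt => /= e /dP[d d0 Hd].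
near=> x; rewrite distrC; apply: Hd; first by rewrite subrr normr0.
by rewrite distrC; near: x; exact: (@cvgr_dist_lt _ _ _ _ _ id).
Unshelve. all: by end_near. Qed.

(** The affine parts of the two line integrals around a small rectangle cancel
    because the form is closed to first order at [(x0, y0)]. *)
Lemma mixed_diff_small (A B P Q : R -> R -> R) (x1 x2 y1 y2 x0 y0 p q r e : R) :
  x1 <= x0 <= x2 -> y1 <= y0 <= y2 -> 0 <= e ->
  (forall x y, x1 <= x <= x2 -> y1 <= y <= y2 -> [/\
     is_derive x 1 (fun t => A t y) (P x y),
     is_derive y 1 (fun t => B x t) (Q x y),
     `|P x y - P x0 y0 - p * (x - x0) - q * (y - y0)|
        <= e * (`|x - x0| + `|y - y0|) &
     `|Q x y - Q x0 y0 - q * (x - x0) - r * (y - y0)|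
        <= e * (`|x - x0| + `|y - y0|)]) ->
  `|mixed_diff (fun x y => B x y - A x y) x1 x2 y1 y2|
    <= 2 * e * (x2 - x1 + (y2 - y1)) ^+ 2.
Proof.
move=> /andP[x10 x02] /andP[y10 y02] e0 H.
have x12 := le_trans x10 x02; have y12 := le_trans y10 y02.
pose s := x2 - x1 + (y2 - y1).
have es x y : x1 <= x <= x2 -> y1 <= y <= y2 ->
    e * (`|x - x0| + `|y - y0|) <= e * s.
  move=> /andP[? ?] /andP[? ?]; apply: ler_wpM2l => //.
  by apply: lerD; rewrite ler_norml; apply/andP; split; lra.
have hA y : y1 <= y <= y2 ->
    `|A x2 y - A x1 y - (P x0 y0 + q * (y - y0)) * (x2 - x1)
       - p * ((x2 - x0) ^+ 2 - (x1 - x0) ^+ 2) / 2| <= e * s * (x2 - x1).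
  move=> yy; apply: (@increment_approx (A^~ y) (P^~ y)) => // t tt.
    by have [] := H t y tt yy.
  have [_ _ h _] := H t y tt yy; apply: le_trans (es _ _ tt yy).
  by move: h; congr (`| _ | <= _); ring.
have hB x : x1 <= x <= x2 ->
    `|B x y2 - B x y1 - (Q x0 y0 + q * (x - x0)) * (y2 - y1)
       - r * ((y2 - y0) ^+ 2 - (y1 - y0) ^+ 2) / 2| <= e * s * (y2 - y1).
  move=> xx; apply: (@increment_approx (B x) (Q x)) => // t tt.
    by have [] := H x t xx tt.
  have [_ _ _ h] := H x t xx tt; apply: le_trans (es _ _ xx tt).
  by move: h; congr (`| _ | <= _); ring.
have := hA y1; have := hA y2; have := hB x1; have := hB x2.
rewrite !lexx x12 y12 => /(_ isT) h1 /(_ isT) h2 /(_ isT) h3 /(_ isT) h4.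
have -> : mixed_diff (fun x y => B x y - A x y) x1 x2 y1 y2 =
  (B x2 y2 - B x2 y1 - (Q x0 y0 + q * (x2 - x0)) * (y2 - y1)
       - r * ((y2 - y0) ^+ 2 - (y1 - y0) ^+ 2) / 2) -
  (B x1 y2 - B x1 y1 - (Q x0 y0 + q * (x1 - x0)) * (y2 - y1)
       - r * ((y2 - y0) ^+ 2 - (y1 - y0) ^+ 2) / 2) -
  (A x2 y2 - A x1 y2 - (P x0 y0 + q * (y2 - y0)) * (x2 - x1)
       - p * ((x2 - x0) ^+ 2 - (x1 - x0) ^+ 2) / 2) +
  (A x2 y1 - A x1 y1 - (P x0 y0 + q * (y1 - y0)) * (x2 - x1)
       - p * ((x2 - x0) ^+ 2 - (x1 - x0) ^+ 2) / 2).
  by rewrite /mixed_diff; ring.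
have -> : 2 * e * (x2 - x1 + (y2 - y1)) ^+ 2 = e * s * (y2 - y1) +
  e * s * (y2 - y1) + e * s * (x2 - x1) + e * s * (x2 - x1) by rewrite /s; ring.
apply: (le_trans (ler_normD _ _)); apply: lerD => //.
apply: (le_trans (ler_normB _ _)); apply: lerD => //.
by apply: (le_trans (ler_normB _ _)); apply: lerD.
Qed.

Section Primitive.
Variables (P Q : R -> R -> R) (a b c d : R).
Hypothesis closedPQ : forall x y, a <= x <= b -> c <= y <= d ->
  exists p q r, fdiff P x y p q /\ fdiff Q x y q r.
Let dom x y := (a < x < b) && (c < y < d).

(** Bisection finds small rectangles around one point on which the mixed difference is
    large compared with the squared size; the first order estimate at that point
    forbids this. *)
Lemma goursat (A B : R -> R -> R) :
  (forall x y, a < x < b -> c < y < d -> is_derive x 1 (A^~ y) (P x y) /\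
     is_derive y 1 (B x) (Q x y)) ->
  forall x1 x2 y1 y2, dom x1 y1 -> dom x2 y2 -> x1 <= x2 -> y1 <= y2 ->
  mixed_diff (fun x y => B x y - A x y) x1 x2 y1 y2 = 0.
Proof.
move=> H x1 x2 y1 y2 /andP[/andP[ax1 x1b] /andP[cy1 y1d]].
move=> /andP[/andP[ax2 x2b] /andP[cy2 y2d]] x12 y12.
set G := fun x y => B x y - A x y.
apply/eqP; rewrite -normr_eq0 eq_le normr_ge0 andbT leNgt; apply/negP => M0.
pose s := x2 - x1 + (y2 - y1) + 1.
have s0 : 1 <= s by rewrite /s; lra.
pose e := `|mixed_diff G x1 x2 y1 y2| / s ^+ 2 / 2.
have e0 : 0 < e by rewrite !divr_gt0// exprn_gt0// (lt_le_trans ltr01).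
have [|x0 [y0 Hb]] := @bisection G e x1 x2 y1 y2 x12 y12.
  have -> : `|mixed_diff G x1 x2 y1 y2| = e * (2 * s ^+ 2).
    by rewrite /e; field; rewrite gt_eqF// (lt_le_trans ltr01).
  rewrite ltr_pM2l//; move: s0; rewrite /s; nra.
have [u [v [u' [v' [[? ? ? ?] [? ? ? ?] _ _]]]]] := Hb 1 ltr01.
have [||p [q [r [dP dQ]]]] := closedPQ (x := x0) (y := y0).
- by apply/andP; split; lra.
- by apply/andP; split; lra.
have e20 : 0 < e / 2 by rewrite divr_gt0.
have [d1 d10 H1] := dP _ e20; have [d2 d20 H2] := dQ _ e20.
have [|a1 [b1 [a2 [b2 [[h1 h2 h3 h4] [k1 k2 k3 k4] small]]]]] := Hb (Num.min d1 d2).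
  by rewrite lt_min d10.
apply/negP; rewrite -leNgt; move: small; rewrite lt_min => /andP[sm1 sm2].
have -> : e = 2 * (e / 2) by field.
apply: (mixed_diff_small (P := P) (Q := Q) (x0 := x0) (y0 := y0) (p := p) (q := q) (r := r)).
- by rewrite h2.
- by rewrite k2.
- exact: ltW.
move=> x y hx hy.
have hx' : a < x < b.
  by case/andP: hx => ? ?; rewrite (lt_le_trans ax1) ?(le_lt_trans _ x2b)//;
    [apply: le_trans h4|apply: le_trans h1 _].
have hy' : c < y < d.
  by case/andP: hy => ? ?; rewrite (lt_le_trans cy1) ?(le_lt_trans _ y2d)//;
    [apply: le_trans k4|apply: le_trans k1 _].
have x0ab : a1 <= x0 <= b1 by rewrite h2.
have y0ab : a2 <= y0 <= b2 by rewrite k2.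
have wx : 0 <= b1 - a1 by rewrite subr_ge0 (le_trans h2).
have wy : 0 <= b2 - a2 by rewrite subr_ge0 (le_trans k2).
have [hA hB] := H x y hx' hy'.
have sm1' := sm1; have sm2' := sm2; rewrite addrC in sm1' sm2'.
split => //.
  exact: H1 (dist_lt_itv hx x0ab wy sm1) (dist_lt_itv hy y0ab wx sm1').
exact: H2 (dist_lt_itv hx x0ab wy sm2) (dist_lt_itv hy y0ab wx sm2').
Qed.

(** By Goursat, B - A is a function of x plus a function of y, and correcting A by the
    latter gives a common primitive. *)
Lemma primitive_exists : a < b -> c < d -> exists Phi : R -> R -> R,
  forall x y, a < x < b -> c < y < d ->
    is_derive x 1 (Phi^~ y) (P x y) /\ is_derive y 1 (Phi x) (Q x y).
Proof.
move=> ab cd.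
have exA y : exists A : R -> R, c <= y <= d ->
    forall x, a < x < b -> is_derive x 1 A (P x y).
  have [yy|ny] := boolP (c <= y <= d); last by exists (fun=> 0).
  have [|A HA] := @antiderivative_exists (P^~ y) a b ab; last by exists A.
  move=> x xx; have [p [q [r [dP _]]]] := closedPQ xx yy.
  exact: fdiff_ctsx dP.
have exB x : exists B : R -> R, a <= x <= b ->
    forall y, c < y < d -> is_derive y 1 B (Q x y).
  have [xx|nx] := boolP (a <= x <= b); last by exists (fun=> 0).
  have [|B HB] := @antiderivative_exists (Q x) c d cd; last by exists B.
  move=> y yy; have [p [q [r [_ dQ]]]] := closedPQ xx yy.
  exact: fdiff_ctsy dQ.
have [A' HA] := choice exA; have [B HB] := choice exB.
pose A x y := A' y x.
have dAB x y : a < x < b -> c < y < d -> is_derive x 1 (A^~ y) (P x y) /\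
     is_derive y 1 (B x) (Q x y).
  move=> xx yy; split.
    by apply: HA xx; case/andP: yy => *; rewrite !ltW.
  by apply: HB yy; case/andP: xx => *; rewrite !ltW.
pose m := (a + b) / 2; pose n := (c + d) / 2.
have hm : a < m < b by rewrite /m; apply/andP; split; lra.
have hn : c < n < d by rewrite /n; apply/andP; split; lra.
pose G x y := B x y - A x y.
have split_G x y : a < x < b -> c < y < d -> G x y = G m y + G x n - G m n.
  move=> xx yy; have g := goursat dAB.
  have dm : dom m n by rewrite /dom hm.
  have dx : dom x y by rewrite /dom xx.
  have dmy : dom m y by rewrite /dom hm.
  have dxn : dom x n by rewrite /dom xx.
  have [mx|/ltW xm] := leP m x; have [ny|/ltW yn] := leP n y.
  - by have := g _ _ _ _ dm dx mx ny; rewrite /mixed_diff /G; lra.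
  - by have := g _ _ _ _ dmy dxn mx yn; rewrite /mixed_diff /G; lra.
  - by have := g _ _ _ _ dxn dmy xm ny; rewrite /mixed_diff /G; lra.
  - by have := g _ _ _ _ dx dm xm yn; rewrite /mixed_diff /G; lra.
exists (fun x y => A x y + G m y) => x y xx yy; split.
  have [dA _] := dAB x y xx yy.
  by apply: is_derive_eq; rewrite addr0.
have [_ dB] := dAB x y xx yy.
have dB' : is_derive y 1 (fun t => B x t - G x n + G m n) (Q x y).
  by apply: is_derive_eq; rewrite subr0 addr0.
apply: near_eq_is_derive dB'.
near=> t.
have tt : c < t < d.
  near: t; move/andP: yy => [cy yd].
  by apply: filterS2 (lt_nbhsr cy) (lt_nbhsl yd) => t /= ? ?; apply/andP.
have := split_G x t xx tt; rewrite /G; lra.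
Unshelve. all: by end_near. Qed.

End Primitive.

(** The mean value theorem on a vertical and then a horizontal segment. *)
Lemma fdiff_of_partials (Phi P Q : R -> R -> R) (a b c d x0 y0 p q p' q' : R) :
  (forall x y, a < x < b -> c < y < d ->
    is_derive x 1 (Phi^~ y) (P x y) /\ is_derive y 1 (Phi x) (Q x y)) ->
  a < x0 < b -> c < y0 < d -> fdiff P x0 y0 p q -> fdiff Q x0 y0 p' q' ->
  fdiff Phi x0 y0 (P x0 y0) (Q x0 y0).
Proof.
move=> H /andP[ax xb] /andP[cy yd] /fdiff_cts dP /fdiff_cts dQ e e0.
have [d1 d10 H1] := dP _ e0; have [d2 d20 H2] := dQ _ e0.
pose m := Num.min (Num.min d1 d2)
  (Num.min (Num.min (x0 - a) (b - x0)) (Num.min (y0 - c) (d - y0))).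
exists m; first by rewrite /m !lt_min d10 d20 !subr_gt0 ax xb cy yd.
move=> x y; rewrite /m !lt_min => /andP[/andP[xd1 xd2] /andP[/andP[xa xb'] _]].
move=> /andP[/andP[yd1 yd2] /andP[_ /andP[yc yd']]].
have mv (F f : R -> R) (u v : R) k :
    (forall t, `|t - v| <= `|u - v| -> is_derive t 1 F (f t) /\ `|f t - k| < e) ->
    `|F u - F v - k * (u - v)| <= e * `|u - v|.
  move=> Hf; have [vu|/ltW uv] := leP v u.
    have [|t /andP[vt tu] ->] := @mean_value F f v u vu.
      by move=> t /andP[? ?]; apply: (Hf t _).1; rewrite !ger0_norm ?subr_ge0//; lra.
    rewrite -mulrBl normrM ler_wpM2r// ltW//; apply: (Hf t _).2.
    by rewrite !ger0_norm ?subr_ge0//; lra.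
  have [|t /andP[ut tv] E] := @mean_value F f u v uv.
    by move=> t /andP[? ?]; apply: (Hf t _).1; rewrite !ler0_norm ?subr_le0//; lra.
  have -> : F u - F v - k * (u - v) = (f t - k) * (u - v).
    by rewrite -[F u - F v]opprB E; ring.
  rewrite normrM ler_wpM2r// ltW//; apply: (Hf t _).2.
  by rewrite !ler0_norm ?subr_le0//; lra.
have -> : Phi x y - Phi x0 y0 - P x0 y0 * (x - x0) - Q x0 y0 * (y - y0) =
  (Phi x y - Phi x0 y - P x0 y0 * (x - x0)) +
  (Phi x0 y - Phi x0 y0 - Q x0 y0 * (y - y0)) by ring.
apply: (le_trans (ler_normD _ _)); rewrite (mulrDr e); apply: lerD.
  apply: (mv (Phi^~ y) (P^~ y)).
  move=> t tx; have tx1 := le_lt_trans tx xd1.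
  split; last exact: H1.
  apply: (H t y _ _).1; apply/andP.
    move: (le_lt_trans tx xa) (le_lt_trans tx xb').
    by rewrite !ltr_norml => /andP[? ?] /andP[? ?]; split; lra.
  by move: yc yd'; rewrite !ltr_norml => /andP[? ?] /andP[? ?]; split; lra.
apply: (mv (Phi x0) (Q x0)).
move=> t ty; have ty1 := le_lt_trans ty yd2.
split; last by apply: H2 => //; rewrite subrr normr0.
apply: (H x0 t _ _).2; first by rewrite ax.
apply/andP; move: (le_lt_trans ty yc) (le_lt_trans ty yd').
by rewrite !ltr_norml => /andP[? ?] /andP[? ?]; split; lra.
Qed.

End Goursat.

(** * The weak maximum principle *)

Section RealAnalysis.

Lemma is_derive_approx (K : numFieldType) (W : normedModType K) (g : K -> W)
    (x : K) (h : W) :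
  is_derive x 1 g h -> forall e, 0 < e -> exists2 d, 0 < d & forall t,
    `|t - x| < d -> `|g t - g x - (t - x) *: h| <= e * `|t - x|.
Proof.
move=> [/derivable_nbhs dg <-] e e0.
move/eqaddoP: dg => /(_ e e0) /nbhs_normP[d /= d0 Hd].
exists d => // t td; have := Hd (t - x).
rewrite /ball_ /= sub0r normrN => /(_ td).
have -> : ((fun h0 : K => g (h0%:A + x)) - (cst (g x) +  *:%R^~ ('D_1 g x))) (t - x)
  = g ((t - x)%:A + x) - (g x + (t - x) *: 'D_1 g x) by [].
by rewrite [_%:A]mulr1 subrK opprD addrA.
Qed.

Variable R : realType.

(** The first derivative vanishes at the maximum; if the second one were positive, the
    first would be positive just after and the function would still increase. *)
Lemma second_derivative_at_max (f g : R -> R) (a b x0 h : R) : a < x0 < b ->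
  (forall t, a < t < b -> is_derive t 1 f (g t)) -> is_derive x0 1 g h ->
  (forall t, a < t < b -> f t <= f x0) -> h <= 0.
Proof.
move=> xx df dg fmax; rewrite leNgt; apply/negP => h0.
have ab : a < b by case/andP: xx; exact: lt_trans.
have g0 : g x0 = 0.
  have [|||_ <-] := @derive1_at_max R f a b x0 (ltW ab).
  - by move=> t; rewrite in_itv => /df [].
  - by rewrite in_itv.
  - by move=> t; rewrite in_itv; exact: fmax.
  by have [_ <-] := df x0 xx.
have h20 : 0 < h / 2 by rewrite divr_gt0.
have [d d0 Hd] := is_derive_approx dg h20.
case/andP: xx => ax xb.
pose m := Num.min d (b - x0) / 2.
have m0 : 0 < m by rewrite /m divr_gt0// lt_min d0 subr_gt0.
have md : m < d by rewrite /m; case: (leP d (b - x0)); lra.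
have mb : m < b - x0 by rewrite /m; case: (leP d (b - x0)); lra.
have pos t : x0 < t <= x0 + m -> 0 < g t.
  move=> /andP[xt tm].
  have tn : `|t - x0| = t - x0 by rewrite ger0_norm// subr_ge0 ltW.
  have /Hd : `|t - x0| < d by rewrite tn; lra.
  rewrite g0 subr0 tn ler_norml => /andP[+ _]; rewrite /GRing.scale/=.
  have : 0 < (t - x0) * h by rewrite mulr_gt0// subr_gt0.
  by lra.
have [||t /andP[xt tm] E] := @mean_value R f g (x0 + m / 2) (x0 + m).
- by lra.
- by move=> t /andP[? ?]; apply: df; apply/andP; split; lra.
have [||s /andP[xs sm] E2] := @mean_value R f g x0 (x0 + m / 2).
- by lra.
- by move=> s /andP[? ?]; apply: df; apply/andP; split; lra.
have gt0 : 0 < g t * (x0 + m - (x0 + m / 2)).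
  by rewrite mulr_gt0//; [apply: pos; apply/andP; split; lra|lra].
have gs0 : 0 <= g s * (x0 + m / 2 - x0).
  rewrite mulr_ge0//; last by lra.
  have [->|sx] := eqVneq s x0; first by rewrite g0.
  by apply/ltW/pos; rewrite lt_neqAle eq_sym sx xs/=; lra.
have /fmax : a < x0 + m < b by apply/andP; split; lra.
by rewrite leNgt => /negP; apply; lra.
Qed.

Lemma rectangle_max (f : R -> R -> R) (a b c d : R) : a <= b -> c <= d ->
  (forall x y, a <= x <= b -> c <= y <= d ->
    {for (x, y), continuous (fun z => f z.1 z.2)}) ->
  exists x0 y0, [/\ a <= x0 <= b, c <= y0 <= d &
    forall x y, a <= x <= b -> c <= y <= d -> f x y <= f x0 y0].
Proof.
move=> ab cd cf.
have [|||[x0 y0]] := @compact_EVT_max _ R (fun z => f z.1 z.2)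
  (`[a, b]%classic `*` `[c, d]%classic).
- by exists (a, c); split; rewrite /= in_itv/= lexx.
- by apply: compact_setX; exact: segment_compact.
- apply: continuous_in_subspaceT => -[x y] /set_mem[/=]; rewrite !in_itv => xx yy.
  exact: cf.
move=> /set_mem[/=]; rewrite !in_itv => xx yy H; exists x0, y0; split => // x y hx hy.
by apply: (H (x, y)); apply/mem_set; split; rewrite /= in_itv.
Qed.

Section WeakMaximum.
Variables (w wx wxx wy wyy : R -> R -> R) (a b c d M : R).
Hypotheses (ab : a <= b) (cd : c <= d).
Hypothesis cw : forall x y, a <= x <= b -> c <= y <= d ->
    {for (x, y), continuous (fun z => w z.1 z.2)}.
Hypothesis dw : forall x y, a < x < b -> c < y < d ->
  [/\ is_derive x 1 (w^~ y) (wx x y), is_derive x 1 (wx^~ y) (wxx x y),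
      is_derive y 1 (w x) (wy x y), is_derive y 1 (wy x) (wyy x y) &
      0 <= wxx x y + wyy x y].
Hypothesis vert : forall y, c <= y <= d -> w a y <= M /\ w b y <= M.
Hypothesis horz : forall x, a <= x <= b -> w x c <= M /\ w x d <= M.

(** After adding a small multiple of [x ^ 2] the Laplacian is positive, so the
    maximum over the rectangle is attained on the boundary. *)
Lemma weak_maximum x y : a <= x <= b -> c <= y <= d -> w x y <= M.
Proof.
move=> xx yy; pose K := (`|a| + `|b|) ^+ 2.
have K0 : 0 <= K by exact: sqr_ge0.
have sqK t : a <= t <= b -> t ^+ 2 <= K.
  move=> /andP[ta tb]; rewrite -real_normK ?num_real// lerXn2r ?nnegrE ?addr_ge0//.
  have := ler_norm (- a); have := ler_norm b.
  have := normr_ge0 a; have := normr_ge0 b.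
  by rewrite normrN => ? ? ? ?; rewrite ler_norml; apply/andP; split; lra.
suff H e : 0 < e -> w x y <= M + e * K.
  apply/ler_addgt0Pr => e e0; apply: (le_trans (H (e / (K + 1)) _)).
    by rewrite divr_gt0// ltr_wpDl.
  rewrite lerD2l mulrAC ler_pdivrMr ?ltr_wpDl//; apply: ler_wpM2l; first exact: ltW.
  by rewrite lerDl.
move=> e0; pose v x y := w x y + e * x ^+ 2.
have [|x0 [y0 [hx hy vmax]]] := @rectangle_max v a b c d ab cd.
  move=> s t hs ht; apply: continuousD; first exact: cw.
  apply: continuousM; first exact: cst_continuous.
  by apply: continuousM; exact: cvg_fst.
suff bd : v x0 y0 <= M + e * K.
  apply: le_trans bd; apply: le_trans (vmax x y xx yy).
  by rewrite lerDl mulr_ge0 ?sqr_ge0// ltW.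
have vb s t : a <= s <= b -> w s t <= M -> v s t <= M + e * K.
  by move=> hs wM; apply: lerD => //; rewrite ler_pM2l// sqK.
have [/eqP ->|ax] := boolP (x0 == a); first by apply: vb; [rewrite lexx|case: (vert hy)].
have [/eqP ->|bx] := boolP (x0 == b); first by apply: vb; [rewrite lexx ab|case: (vert hy)].
have [/eqP ->|cy] := boolP (y0 == c); first by apply: vb; case: (horz hx).
have [/eqP ->|dy] := boolP (y0 == d); first by apply: vb; case: (horz hx).
have hx' : a < x0 < b by case/andP: hx => ? ?; rewrite !lt_neqAle eq_sym ax bx; apply/andP.
have hy' : c < y0 < d by case/andP: hy => ? ?; rewrite !lt_neqAle eq_sym cy dy; apply/andP.
have [_ d2 _ d4 lap] := dw hx' hy'.
have xxneg : wxx x0 y0 + e * 2 <= 0.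
  apply: (@second_derivative_at_max (v^~ y0) (fun t => wx t y0 + e * (2 * t)) a b x0) => //.
  - move=> t ht; have [d1 _ _ _ _] := dw ht hy'.
    by rewrite /v; apply: is_derive_eq; rewrite /GRing.scale/=; ring.
  - by apply: is_derive_eq; rewrite /GRing.scale/=; ring.
  - by move=> t /andP[? ?]; apply: vmax => //; rewrite !ltW.
have yyneg : wyy x0 y0 <= 0.
  apply: (@second_derivative_at_max (v x0) (wy x0) c d y0) => //.
  - move=> t ht; have [_ _ d3 _ _] := dw hx' ht.
    by rewrite /v; apply: is_derive_eq; rewrite addr0.
  - by move=> t /andP[? ?]; apply: vmax => //; rewrite !ltW.
by exfalso; lra.
Qed.
End WeakMaximum.
End RealAnalysis.

(** * Unique continuation along a segment *)

Section UniqueContinuation.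
Variable R : realType.

Lemma fdiff_continuous (P : R -> R -> R) (x0 y0 p q : R) : fdiff P x0 y0 p q ->
  {for (x0, y0), continuous (fun z => P z.1 z.2)}.
Proof.
move=> /fdiff_cts dP; apply/cvgrPdist_lt => /= e /dP[d d0 Hd].
have h1 : z.1 @[z --> (x0, y0)] --> x0 by exact: cvg_fst.
have h2 : z.2 @[z --> (x0, y0)] --> y0 by exact: cvg_snd.
move/cvgrPdist_lt : h1 => /(_ _ d0) h1; move/cvgrPdist_lt : h2 => /(_ _ d0) h2.
by apply: filterS2 h1 h2 => z; rewrite distrC => ? ?; rewrite distrC; apply: Hd => //;
  rewrite distrC.
Qed.

Lemma fdiff_derivex (P : R -> R -> R) (x0 y0 p q : R) : fdiff P x0 y0 p q ->
  is_derive x0 1 (P^~ y0) p.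
Proof.
move=> dP.
have H : (fun h => h^-1 *: ((P^~ y0 \o shift x0) (h *: 1) - P x0 y0)) @ 0^' --> p.
  apply/cvgrPdist_le => /= e /dP[d d0 Hd].
  near=> h.
  have h0 : h != 0 by near: h; exact: nbhs_dnbhs_neq.
  have hd : `|h| < d by near: h; exact: dnbhs0_lt.
  have := Hd (h + x0) y0; rewrite addrK subrr normr0 mulr0 subr0 addr0 => /(_ hd d0).
  rewrite [h *: 1]mulr1 /= => Hh.
  have -> : p - h^-1 *: (P (h + x0) y0 - P x0 y0) =
     - (h^-1 * (P (h + x0) y0 - P x0 y0 - p * h)) by rewrite /GRing.scale/=; field.
  rewrite normrN normrM normfV mulrC ler_pdivrMr ?normr_gt0//.
by apply: DeriveDef; [apply/cvg_ex; exists p|apply: cvg_lim].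
Unshelve. all: by end_near. Qed.

Lemma fdiff_swap (P : R -> R -> R) (x0 y0 p q : R) : fdiff P x0 y0 p q ->
  fdiff (fun y x => P x y) y0 x0 q p.
Proof.
move=> dP e e0; have [d d0 Hd] := dP e e0; exists d => // y x yd xd.
by rewrite (addrC `|y - y0|); have := Hd x y xd yd; congr (`|_| <= _); ring.
Qed.

Lemma fdiff_derivey (P : R -> R -> R) (x0 y0 p q : R) : fdiff P x0 y0 p q ->
  is_derive y0 1 (P x0) q.
Proof. by move=> /fdiff_swap /fdiff_derivex. Qed.

Lemma fdiffN (P : R -> R -> R) (x0 y0 p q : R) : fdiff P x0 y0 p q ->
  fdiff (fun x y => - P x y) x0 y0 (- p) (- q).
Proof.
move=> dP e e0; have [d d0 Hd] := dP e e0; exists d => // x y xd yd.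
have := Hd x y xd yd; rewrite -normrN; congr (`|_| <= _); ring.
Qed.

Section Weighted.
Variables (U V u v p q : R -> R -> R) (L d : R).
Hypotheses (L0 : 0 < L) (d0 : 0 < d).
Hypothesis holo : forall x y, 0 <= x <= L -> - d <= y <= d ->
  [/\ fdiff U x y (u x y) (- v x y), fdiff V x y (v x y) (u x y),
      fdiff u x y (p x y) (- q x y) & fdiff v x y (q x y) (p x y)].
Hypothesis zero_left : forall y, - d <= y <= d -> U 0 y = 0 /\ V 0 y = 0.

(* k is such that phi, the real part of exp (- k z), is zero for y = d and y = - d *)
Let k : R := pi / (2 * d).
Let phi x y : R := expR (- (k * x)) * cos (k * y).
Let sigma x y : R := expR (- (k * x)) * sin (k * y).
Let rho x y := U x y ^+ 2 + V x y ^+ 2.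
Let E m x y := expR (m * phi x y).

Let rho_bound : exists2 M, 0 <= M &
  forall x y, 0 <= x <= L -> - d <= y <= d -> rho x y <= M.
Proof.
have [||x0 [y0 [hx hy H]]] := @rectangle_max R rho 0 L (- d) d (ltW L0).
- by have d1 := d0; lra.
- move=> x y hx hy; have [dU dV _ _] := holo hx hy.
  have cU := fdiff_continuous dU; have cV := fdiff_continuous dV.
  by apply: continuousD; [exact: (continuousM cU cU)|exact: (continuousM cV cV)].
by exists (rho x0 y0) => //; rewrite addr_ge0 ?sqr_ge0.
Qed.

(** The squared modulus of F = U + i V times the weight E is subharmonic. On the
    horizontal sides the weight is 1, on the left side F is zero, and on the right side
    the weight is at most the exponential factor of the bound. *)
Let weighted_bound m M : 0 <= m -> 0 <= M ->
  (forall x y, 0 <= x <= L -> - d <= y <= d -> rho x y <= M) ->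
  forall x y, 0 <= x <= L -> - d <= y <= d ->
  rho x y * E m x y <= M * expR (m * expR (- (k * L))).
Proof.
move=> m0 M0 rhoM; have d1 := d0.
pose rx x y := 2 * (U x y * u x y + V x y * v x y).
pose ry x y := 2 * (V x y * u x y - U x y * v x y).
pose rxx x y := 2 * (u x y ^+ 2 + v x y ^+ 2 + U x y * p x y + V x y * q x y).
pose ryy x y := 2 * (u x y ^+ 2 + v x y ^+ 2 - U x y * p x y - V x y * q x y).
pose wx x y := (rx x y - k * m * phi x y * rho x y) * E m x y.
pose wxx x y := (rxx x y - 2 * k * m * phi x y * rx x y +
  (k ^+ 2 * m * phi x y + (k * m * phi x y) ^+ 2) * rho x y) * E m x y.
pose wy x y := (ry x y - k * m * sigma x y * rho x y) * E m x y.
pose wyy x y := (ryy x y - 2 * k * m * sigma x y * ry x y +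
  (- (k ^+ 2 * m * phi x y) + (k * m * sigma x y) ^+ 2) * rho x y) * E m x y.
have k0 : 0 < k by rewrite divr_gt0 ?pi_gt0// mulr_gt0.
have Epos x y : 0 < E m x y by exact: expR_gt0.
have eL1 : 1 <= expR (m * expR (- (k * L))).
  by rewrite -[leLHS]expR0 ler_expR mulr_ge0// expR_ge0.
apply: (@weak_maximum R _ wx wxx wy wyy); rewrite ?(ltW L0)//; first by lra.
- move=> x y hx hy; have [dU dV _ _] := holo hx hy.
  have cU := fdiff_continuous dU; have cV := fdiff_continuous dV.
  have cphi : {for (x, y), continuous (fun z : R * R => phi z.1 z.2)}.
    apply: continuousM.
      apply: continuous_comp; last exact: continuous_expR.
      apply: continuousN; apply: continuousM; [exact: cst_continuous|exact: cvg_fst].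
    apply: continuous_comp; last exact: continuous_cos.
    by apply: continuousM; [exact: cst_continuous|exact: cvg_snd].
  apply: continuousM.
    by apply: continuousD; [exact: (continuousM cU cU)|exact: (continuousM cV cV)].
  apply: continuous_comp; last exact: continuous_expR.
  by apply: continuousM => //; exact: cst_continuous.
- move=> x y /andP[x0 xL] /andP[yd dy].
  have [||dU dV du dv] := holo (x := x) (y := y); [by rewrite !ltW..|].
  have Ux := fdiff_derivex dU; have Uy := fdiff_derivey dU.
  have Vx := fdiff_derivex dV; have Vy := fdiff_derivey dV.
  have ux := fdiff_derivex du; have uy := fdiff_derivey du.
  have vx := fdiff_derivex dv; have vy := fdiff_derivey dv.
  have phix : is_derive x 1 (phi^~ y) (- (k * phi x y)).
    by rewrite /phi; apply: is_derive_eq; rewrite /GRing.scale/=; ring.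
  have phiy : is_derive y 1 (phi x) (- (k * sigma x y)).
    by rewrite /phi; apply: is_derive_eq; rewrite /sigma /GRing.scale/=; ring.
  have sigmay : is_derive y 1 (sigma x) (k * phi x y).
    by rewrite /sigma; apply: is_derive_eq; rewrite /phi /GRing.scale/=; ring.
  have Ex : is_derive x 1 ((E m)^~ y) (- (k * m * phi x y) * E m x y).
    by rewrite /E; apply: is_derive_eq; rewrite /GRing.scale/=; ring.
  have Ey : is_derive y 1 ((E m) x) (- (k * m * sigma x y) * E m x y).
    by rewrite /E; apply: is_derive_eq; rewrite /GRing.scale/=; ring.
  split.
  + by rewrite /rho; apply: is_derive_eq; rewrite /wx /rx /rho /GRing.scale/=; ring.
  + by rewrite /wx /rx /rho; apply: is_derive_eq; rewrite /wxx /rxx /rx /rho /GRing.scale/=; ring.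
  + by rewrite /rho; apply: is_derive_eq; rewrite /wy /ry /rho /GRing.scale/=; ring.
  + by rewrite /wy /ry /rho; apply: is_derive_eq; rewrite /wyy /ryy /ry /rho /GRing.scale/=; ring.
  (* with a - i b the logarithmic derivative of the weight, the Laplacian is the
     weight times the squared modulus of F (a - i b) + 2 F' *)
  pose a := - (k * m * phi x y); pose b := - (k * m * sigma x y).
  have -> : wxx x y + wyy x y = ((a * U x y + b * V x y + 2 * u x y) ^+ 2 +
      (a * V x y - b * U x y + 2 * v x y) ^+ 2) * E m x y.
    by rewrite /wxx /wyy /rxx /ryy /rx /ry /rho /a /b; ring.
  by rewrite mulr_ge0 ?(ltW (Epos _ _))// addr_ge0 ?sqr_ge0.
- move=> y hy; split.
    have [U0 V0] := zero_left hy.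
    by rewrite /rho U0 V0 expr0n/= addr0 mul0r mulr_ge0// expR_ge0.
  have LL : 0 <= L <= L by rewrite lexx ltW.
  rewrite ler_pM ?expR_ge0 ?addr_ge0 ?sqr_ge0 ?rhoM//.
  rewrite ler_expR ler_wpM2l// /phi ler_piMr ?expR_ge0// cos_le1.
- move=> x hx.
  have c0 : cos (k * d) = 0.
    have -> : k * d = pi / 2 by rewrite /k; field; rewrite gt_eqF.
    exact: cos_pihalf.
  have dd : - d <= d <= d by rewrite lexx; lra.
  have dd' : - d <= - d <= d by rewrite lexx; lra.
  by split; rewrite /E /phi ?mulrN ?cosN c0 !mulr0 expR0 ler_pM ?addr_ge0 ?sqr_ge0 ?rhoM.
Qed.

(** At an interior point of the axis the weight exceeds its maximum on the right side, by
    a factor that grows with m; letting m tend to infinity forces F to vanish. *)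
Lemma zero_on_axis x : 0 < x < L -> U x 0 = 0 /\ V x 0 = 0.
Proof.
move=> /andP[x0 xL]; have [M M0 rhoM] := rho_bound; have d1 := d0.
have k0 : 0 < k by rewrite divr_gt0 ?pi_gt0// mulr_gt0.
pose g := expR (- (k * x)) - expR (- (k * L)).
have g0 : 0 < g by rewrite subr_gt0 ltr_expR ltrN2 ltr_pM2l.
have hx : 0 <= x <= L by rewrite !ltW.
have h0 : - d <= 0 <= d by apply/andP; split; lra.
have bound m : 0 <= m -> rho x 0 * (1 + m * g) <= M.
  move=> m0; have := weighted_bound m0 M0 rhoM hx h0.
  rewrite /E /phi mulr0 cos0 mulr1 -ler_pdivrMr ?expR_gt0// -mulrA -expRN -expRD.
  rewrite -mulrBr; apply: le_trans.
  by apply: ler_wpM2l; [rewrite addr_ge0 ?sqr_ge0|exact: expR_ge1Dx].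
suff /eqP : rho x 0 = 0.
  by rewrite paddr_eq0 ?sqr_ge0// !sqrf_eq0 => /andP[/eqP ? /eqP ?].
apply/eqP; rewrite eq_le addr_ge0 ?sqr_ge0// andbT leNgt; apply/negP => r0.
have := bound (M / (rho x 0 * g)); rewrite divr_ge0 ?mulr_ge0 ?(ltW r0) ?(ltW g0)//.
move=> /(_ isT); have -> : rho x 0 * (1 + M / (rho x 0 * g) * g) = rho x 0 + M.
  by field; rewrite !gt_eqF.
lra.
Qed.

End Weighted.

(** A holomorphic function f = u + i v that is only known to be differentiable once is
    replaced by its primitive, which is differentiable twice. A thin rectangle with its
    left side in the zero set of f makes the primitive constant on the axis. *)
Lemma real_unique_continuation (u v : R -> R -> R) (a b c r : R) :
  a < 0 < b -> 0 < c -> 0 < r ->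
  (forall x y, a <= x <= b -> - c <= y <= c ->
    exists p q, fdiff u x y p (- q) /\ fdiff v x y q p) ->
  (forall x y, `|x| < r -> `|y| < r -> u x y = 0 /\ v x y = 0) ->
  forall x, 0 < x < b -> u x 0 = 0 /\ v x 0 = 0.
Proof.
move=> /andP[a0 b0] c0 r0 holo uv0.
have cc : - c < c by lra.
have [|||U HU] := @primitive_exists R u (fun x y => - v x y) a b (- c) c => //.
- move=> x y hx hy; have [p [q [du dv]]] := holo x y hx hy.
  by exists p, (- q), (- p); split => //; exact: fdiffN.
- exact: lt_trans b0.
have [|||V HV] := @primitive_exists R v u a b (- c) c => //.
- move=> x y hx hy; have [p [q [du dv]]] := holo x y hx hy.
  by exists q, p, (- q); split.
- exact: lt_trans b0.
pose d := Num.min r c / 2.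
have d0 : 0 < d by rewrite divr_gt0// lt_min r0.
have dr : d < r by rewrite /d; case: (leP r c) => ?; lra.
have dc : d < c by rewrite /d; case: (leP r c) => ?; lra.
move=> x /andP[x0 xb]; pose L := (x + b) / 2.
have L0 : 0 < L by rewrite /L; lra.
have xL : x < L by rewrite /L; lra.
have Lb : L < b by rewrite /L; lra.
have /choice[pq Hpq] : forall z : R * R, exists pq : R * R,
    a <= z.1 <= b -> - c <= z.2 <= c ->
    fdiff u z.1 z.2 pq.1 (- pq.2) /\ fdiff v z.1 z.2 pq.2 pq.1.
  move=> [s t]/=; have [hs|] := boolP (a <= s <= b); last by exists (0, 0).
  have [ht|] := boolP (- c <= t <= c); last by exists (0, 0).
  by have [p [q H]] := holo s t hs ht; exists (p, q).
have vertical (W w : R -> R -> R) :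
    (forall y, - c < y < c -> is_derive y 1 (W 0) (w 0 y)) ->
    (forall y, `|y| < r -> w 0 y = 0) ->
    forall y, - d <= y <= d -> W 0 y - W 0 0 = 0.
  move=> dW w0 y /andP[dy yd].
  have [y0|/ltW y0] := leP 0 y.
    have [|t /andP[t0 ty] ->] := @mean_value R (W 0) (w 0) 0 y y0.
      by move=> t /andP[? ?]; apply: dW; apply/andP; split; lra.
    by rewrite w0 ?mul0r// ltr_norml; apply/andP; split; lra.
  have [|t /andP[t0 ty] /eqP] := @mean_value R (W 0) (w 0) y 0 y0.
    by move=> t /andP[? ?]; apply: dW; apply/andP; split; lra.
  rewrite w0 ?mul0r; first by rewrite subr_eq0 => /eqP ->; rewrite subrr.
  by rewrite ltr_norml; apply/andP; split; lra.
have a0b : a < 0 < b by rewrite a0.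
have fdiffB (W : R -> R -> R) k s t p q : fdiff W s t p q ->
    fdiff (fun x y => W x y - k) s t p q.
  move=> dW e e0; have [d' d'0 Hd] := dW e e0; exists d' => // x' y' hx hy.
  by have := Hd x' y' hx hy; congr (`|_| <= _); ring.
have UV0 t : 0 < t < L -> U t 0 - U 0 0 = 0 /\ V t 0 - V 0 0 = 0.
  move: t; apply: (@zero_on_axis (fun x y => U x y - U 0 0) (fun x y => V x y - V 0 0)
    u v (fun x y => (pq (x, y)).1) (fun x y => (pq (x, y)).2) L d L0 d0).
    move=> s y /andP[s0 sL] /andP[dy yd].
    have hs : a < s < b by apply/andP; split; lra.
    have hy : - c < y < c by apply/andP; split; lra.
    have hs' : a <= s <= b by apply/andP; split; lra.
    have hy' : - c <= y <= c by apply/andP; split; lra.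
    have [/= du dv] := Hpq (s, y) hs' hy'.
    split; [| |exact: du|exact: dv].
      exact: fdiffB (fdiff_of_partials HU hs hy du (fdiffN dv)).
    exact: fdiffB (fdiff_of_partials HV hs hy dv du).
  move=> y hy; split.
    apply: (vertical U (fun x y => - v x y)) => // t ht; first by case: (HU 0 t a0b ht).
    by have [|_ ->] := uv0 0 t _ ht; rewrite ?normr0 ?oppr0.
  apply: (vertical V u) => // t ht; first by case: (HV 0 t a0b ht).
  by have [|-> _] := uv0 0 t _ ht; rewrite ?normr0.
have vanish (W w : R -> R -> R) : is_derive x 1 (W^~ 0) (w x 0) ->
    (forall t, 0 < t < L -> W t 0 - W 0 0 = 0) -> w x 0 = 0.
  move=> dW W0; have : is_derive x 1 (fun=> W 0 0) (w x 0).
    apply: near_eq_is_derive dW; near=> t.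
    apply/eqP; rewrite -subr_eq0 W0//; apply/andP; split; near: t.
      exact: lt_nbhsr.
    exact: lt_nbhsl.
  by move=> [_ <-]; rewrite derive_cst.
have hx : a < x < b by apply/andP; split; lra.
have h0 : - c < 0 < c by apply/andP; split; lra.
split.
  by apply: (vanish U) => [|t /UV0[]//]; case: (HU x 0 hx h0).
by apply: (vanish V) => [|t /UV0[]//]; case: (HV x 0 hx h0).
Unshelve. all: by end_near. Qed.

End UniqueContinuation.

(** * Holomorphic functions on balls *)

Local Open Scope complex_scope.

Section IdentityPrinciple.
Variable R : realType.
Local Notation C := R[i]^o.

Lemma posc_real (e : R[i]) : 0 < e -> exists2 r : R, 0 < r & e = r%:C.
Proof.
case: e => r i; rewrite ltcE/= => /andP[/eqP -> r0].
by exists r.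
Qed.

Lemma normc_real (V : normedModType R[i]) (z : V) : exists2 r : R, 0 <= r & `|z| = r%:C.
Proof.
exists (complex.Re `|z|); last by rewrite RRe_real ?normr_real.
by rewrite -ler0c RRe_real ?normr_real.
Qed.

Lemma ler_Re_norm (z : R[i]) (r : R) : `|z| <= r%:C -> `|complex.Re z| <= r.
Proof.
rewrite normc_def lecR; apply: le_trans.
by rewrite -sqrtr_sqr ler_sqrt ?lerDl ?addr_ge0 ?sqr_ge0.
Qed.

Lemma ler_Im_norm (z : R[i]) (r : R) : `|z| <= r%:C -> `|complex.Im z| <= r.
Proof.
rewrite normc_def lecR; apply: le_trans.
by rewrite -sqrtr_sqr ler_sqrt ?lerDr ?addr_ge0 ?sqr_ge0.
Qed.

Lemma norm_real_complex (x : R) : `|x%:C| = `|x|%:C.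
Proof. by rewrite normc_def/= expr0n/= addr0 sqrtr_sqr. Qed.

Lemma ler_norm_ReIm (x y : R) : `|(x +i* y : R[i])| <= (`|x| + `|y|)%:C.
Proof.
have -> : x +i* y = x%:C + (0 +i* y) by apply/eqP; rewrite eq_complex/= addr0 add0r !eqxx.
apply: (le_trans (ler_normD _ _)); rewrite rmorphD/= lerD//.
  by rewrite norm_real_complex.
by rewrite normc_def/= expr0n/= add0r sqrtr_sqr.
Qed.

Lemma cauchy_riemann (G : C -> C) (x0 y0 : R) :
  derivable G (x0 +i* y0 : C) (1 : C) ->
  exists p q, fdiff (fun x y => complex.Re (G (x +i* y))) x0 y0 p (- q) /\
    fdiff (fun x y => complex.Im (G (x +i* y))) x0 y0 q p.
Proof.
move=> /derivableP; set D := ('D_(1 : C) _ _) => dG.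
exists (complex.Re D), (complex.Im D).
have approx e : 0 < e -> exists2 d, 0 < d & forall x y,
    `|x - x0| < d -> `|y - y0| < d ->
    `|(G (x +i* y) - G (x0 +i* y0) - ((x - x0) +i* (y - y0)) * D : R[i])| <=
      (e * (`|x - x0| + `|y - y0|))%:C.
  move=> e0; have ec : (0 : R[i]) < e%:C by rewrite ltcR.
  have [d' /posc_real[d d0 ->] Hd] := is_derive_approx dG ec.
  exists (d / 2); first by rewrite divr_gt0.
  move=> x y xd yd.
  have E : (x +i* y) - (x0 +i* y0) = (x - x0) +i* (y - y0) by [].
  have := Hd (x +i* y); rewrite E => H.
  have small : `|(x - x0) +i* (y - y0)| < d%:C.
    by apply: (le_lt_trans (ler_norm_ReIm _ _)); rewrite ltcR; lra.
  apply: (le_trans (H small)); rewrite rmorphM/= ler_wpM2l ?ler_norm_ReIm//.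
  exact: ltW.
split=> e /approx[d d0 Hd]; exists d => // x y xd yd; have := Hd x y xd yd.
  move=> /ler_Re_norm; case: (G _) => g1 g2; case: (G _) => g3 g4; case: (D) => p q /=.
  by congr (`|_| <= _); ring.
move=> /ler_Im_norm; case: (G _) => g1 g2; case: (G _) => g3 g4; case: (D) => p q /=.
by congr (`|_| <= _); ring.
Qed.

Lemma derivable_line n (f : 'rV[C]_n -> C) (a v : 'rV[C]_n) (t : C) :
  differentiable f (a + t *: v) -> derivable (fun s : C => f (a + s *: v)) t (1 : C).
Proof.
move=> df; apply/derivable1_diffP.
apply: (@differentiable_comp _ _ _ _ (fun s : C => a + s *: v) f) => //.
Qed.

Lemma affine_split (K : nzRingType) (V : lmodType K) (a c z : V) (s t : K) :
  a + (s + t) *: (z - a) - c =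
  (1 - s) *: (a - c) + s *: (z - c) + t *: (z - a).
Proof.
have -> : (1 - s) *: (a - c) + s *: (z - c) = a - c + s *: (z - a).
  rewrite scalerBl scale1r -addrA; congr (_ + _).
  by rewrite addrC -scalerBr opprB addrA subrK.
rewrite scalerDl addrA [LHS]addrAC; congr (_ + _); exact: addrAC.
Qed.

(** On the complex line through a and z the statement is that of two real functions of
    two variables, and a neighbourhood of the segment from 0 to 1 is mapped into the
    ball by convexity. *)
Lemma ball_identity n (f : 'rV[C]_n -> C) (c a z : 'rV[C]_n) (e : R[i]) :
  (forall w, ball c e w -> differentiable f w) ->
  ball c e a -> ball c e z -> (\forall w \near a, f w = 0) -> f z = 0.
Proof.
have ballE w : ball c e w = (`|w - c| < e) by rewrite -ball_normE /= distrC.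
rewrite !ballE => df ae ze /nbhs_normP[r0 /= r00 Hr0].
have e0 : 0 < e by apply: le_lt_trans ae; exact: normr_ge0.
have [e' e'0 Ee] := posc_real e0; have [r r'0 Er] := posc_real r00.
have [na na0 Ena] := normc_real (a - c); have [nz nz0 Enz] := normc_real (z - c).
pose v := z - a; have [nv nv0 Env] := normc_real v.
move: ae ze; rewrite Ena Enz Ee !ltcR => ae ze.
(* a rectangle around the segment from 0 to 1 with margin h is mapped into the ball *)
pose h := Num.min (e' - na) (e' - nz) / (4 * (nv + 1)).
have h0 : 0 < h by rewrite divr_gt0 ?mulr_gt0 ?ltr_wpDl// lt_min !subr_gt0 ae.
have hnv : 2 * h * nv < Num.min (e' - na) (e' - nz).
  have E : h * (4 * (nv + 1)) = Num.min (e' - na) (e' - nz).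
    by rewrite /h divfK// gt_eqF// mulr_gt0// ltr_wpDl.
  by rewrite -E; nra.
pose G (t : C) := f (a + t *: v).
have dG x y : - h <= x <= 1 + h -> - h <= y <= h ->
    derivable G (x +i* y : C) (1 : C).
  move=> hx hy; apply: derivable_line; apply: df; rewrite ballE Ee.
  (* the point of the segment closest to x *)
  pose x' := Num.min 1 (Num.max 0 x).
  have hx' : 0 <= x' <= 1 /\ `|x - x'| <= h.
    rewrite /x'; case/andP: hx => hx1 hx2; case: (leP 0 x) => ?.
      by case: (leP 1 x) => ?; rewrite ?subrr ?normr0 ?(ltW h0) ?ler01 ?lexx;
       split => //; rewrite ?ger0_norm; lra.
    have -> : Num.min (1 : R) 0 = 0 by rewrite min_r ?ler01.
    by rewrite lexx ler01 subr0 ltr0_norm//; split => //; lra.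
  case: hx' => /andP[x'0 x'1] xx'.
  have -> : a + (x +i* y : C) *: v - c =
      ((1 - x')%:C *: (a - c) + x'%:C *: (z - c)) + ((x - x') +i* y : C) *: v.
    have -> : (x +i* y : C) = x'%:C + ((x - x') +i* y).
      by apply/eqP; rewrite eq_complex/= add0r addrC subrK !eqxx.
    by rewrite rmorphB rmorph1; exact: affine_split.
  apply: (le_lt_trans (ler_normD _ _)).
  apply: (@le_lt_trans _ _ ((1 - x') * na + x' * nz + 2 * h * nv)%:C).
    rewrite [leRHS]rmorphD/=; apply: lerD.
      have H1 := ler_normD ((1 - x')%:C *: (a - c)) (x'%:C *: (z - c)).
      apply: (le_trans H1); rewrite !normrZ Ena Enz !norm_real_complex.
      by rewrite rmorphD !rmorphM/= !ger0_norm ?subr_ge0.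
    rewrite normrZ Env rmorphM/= ler_wpM2r ?ler0c//.
    apply: (le_trans (ler_norm_ReIm _ _)); rewrite lecR.
    have : `|y| <= h by rewrite ler_norml.
    by lra.
  rewrite ltcR; move: hnv; rewrite lt_min => /andP[h1 h2].
  have [nn|/ltW nn] := leP na nz.
    have : 0 <= (1 - x') * (nz - na) by rewrite mulr_ge0 ?subr_ge0.
    by lra.
  have : 0 <= x' * (na - nz) by rewrite mulr_ge0 ?subr_ge0.
  by lra.
pose u x y := complex.Re (G (x +i* y)); pose w x y := complex.Im (G (x +i* y)).
pose s := r / (2 * (nv + 1)).
have s0 : 0 < s by rewrite divr_gt0// mulr_gt0// ltr_wpDl.
have [||||/=] := @real_unique_continuation R u w (- h) (1 + h) h s _ h0 s0 _ _ 1.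
- by apply/andP; split; lra.
- by move=> x y hx hy; exact: cauchy_riemann (dG x y hx hy).
- move=> x y xs ys; rewrite /u /w /G Hr0//= opprD addNKr normrN normrZ Env Er.
  apply: (@le_lt_trans _ _ ((`|x| + `|y|) * nv)%:C).
    by rewrite rmorphM/= ler_wpM2r ?ler0c// ler_norm_ReIm.
  rewrite ltcR.
  have E : s * (2 * (nv + 1)) = r by rewrite /s divfK// gt_eqF// mulr_gt0// ltr_wpDl.
  by rewrite -E; nra.
- by apply/andP; split; lra.
rewrite /u /w /G; have -> : a + (1 +i* 0 : C) *: v = z by rewrite scale1r /v addrC subrK.
by case: (f z) => ? ? /= -> ->.
Qed.

End IdentityPrinciple.

(** * Meromorphic functions and the identity principle *)

Section Meromorphic.
Variable R : realType.
Local Notation C := R[i]^o.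

(** The function h may vanish identically, so that the whole space is of this kind; the
    polar sets of meromorphic functions are the examples of interest. *)
Definition analytic_set n (Z : set 'rV[C]_n) : Prop :=
  forall a, exists U (h : 'rV[C]_n -> C),
    [/\ open_nbhs a U, holomorphic U h & forall z, U z -> (Z z <-> h z = 0)].

(** Along the segment from a point of the interior to any other point, the
    parameters whose image is interior form a set that is open and closed. *)
Lemma analytic_set_full n (Z : set 'rV[C]_n) (a : 'rV[C]_n) :
  analytic_set Z -> nbhs a Z -> forall z, Z z.
Proof.
move=> anZ Za z; pose v := z - a.
pose path (t : R) := a + (t%:C : C) *: v.
have [nv nv0 Env] := normc_real v.
have path_dist s t : `|path s - path t| = (`|s - t| * nv)%:C.
  have -> : path s - path t = ((s - t)%:C : C) *: v.
    by rewrite /path opprD addrACA subrr add0r -scalerBl rmorphB.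
  by rewrite normrZ norm_real_complex Env rmorphM.
have cpath t (A : set 'rV[C]_n) : nbhs (path t) A -> \forall s \near t, A (path s).
  move=> /nbhs_normP[e0 /= /posc_real[e e'0 ->] He].
  apply/nbhs_normP; exists (e / (nv + 1)); first by rewrite /= divr_gt0// ltr_wpDl.
  move=> s /= st; apply: He; rewrite /= path_dist ltcR.
  have := st; rewrite ltr_pdivlMr ?ltr_wpDl// mulrDr mulr1.
  by apply: le_lt_trans; rewrite lerDl.
pose G := [set t : R | nbhs (path t) Z].
suff GT : G = setT.
  have : G 1 by rewrite GT.
  by move=> /nbhs_singleton; rewrite /path scale1r /v addrC subrK.
have conn : connected [set: R] by apply/connected_intervalP.
apply: conn.
- by exists 0; rewrite /G/= /path scale0r addr0.
- exists G; last by rewrite setTI.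
  rewrite openE => t /nbhs_interior Ht.
  exact: cpath Ht.
- exists G; last by rewrite setTI.
  move=> t clG; rewrite /G/=.
  have [U [h [[oU Ut] hU hZ]]] := anZ (path t).
  have nU : nbhs (path t) U by exact: open_nbhs_nbhs.
  have [e /= e0 He] := (nbhs_ballP (path t) U).1 nU.
  have near_e : nbhs (path t) (ball (path t) e) by exact: nbhsx_ballx.
  have [s [Gs ps]] := clG _ (cpath _ _ near_e).
  apply: filterS near_e => w we; apply/hZ; first exact: He.
  have dh w' : ball (path t) e w' -> differentiable h w'.
    by move=> w'e; apply: hU; exact: He.
  have Us : nbhs (path s) U by apply: open_nbhs_nbhs; split; last exact: He.
  apply: (ball_identity dh ps we).
  by apply: filterS2 Us Gs => x Ux /hZ; apply.
Qed.

(** An analytic set with an interior point is everything. *)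
Lemma analytic_set_dense n (Z : set 'rV[C]_n) (a : 'rV[C]_n) :
  analytic_set Z -> ~ Z a -> dense (~` Z).
Proof.
move=> anZ Za O [b Ob] oO; apply: contrapT => noZ; apply: Za.
apply: (analytic_set_full (a := b)) => //.
have : nbhs b O by apply: open_nbhs_nbhs.
apply: filterS => w Ow; apply: contrapT => nZ; apply: noZ.
by exists w.
Qed.

Lemma holomorphicS n (U V : set 'rV[C]_n) f : U `<=` V -> holomorphic V f ->
  holomorphic U f.
Proof. by move=> UV hf z /UV; exact: hf. Qed.

Lemma holomorphicD n (U : set 'rV[C]_n) f g : holomorphic U f -> holomorphic U g ->
  holomorphic U (fun z => f z + g z).
Proof. by move=> hf hg z Uz; apply: differentiableD; [exact: hf|exact: hg]. Qed.

Lemma holomorphicM n (U : set 'rV[C]_n) (f g : 'rV[C]_n -> C) :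
  holomorphic U f -> holomorphic U g -> holomorphic U (fun z => f z * g z).
Proof. by move=> hf hg z Uz; apply: differentiableM; [exact: hf|exact: hg]. Qed.

Lemma holomorphic_cst n (U : set 'rV[C]_n) (c : C) : holomorphic U (fun=> c).
Proof. by move=> z Uz; exact: differentiable_cst. Qed.

Lemma open_nbhsI n (a : 'rV[C]_n) U V : open_nbhs a U -> open_nbhs a V ->
  open_nbhs a (U `&` V).
Proof. by move=> [oU Ua] [oV Va]; split; [exact: openI|split]. Qed.

Lemma polar_analytic n (f : merofun R n) : meromorphic f -> analytic_set (polar f).
Proof.
move=> [_ H] a; have [U [g [h [oU hg hh Hz]]]] := H a.
by exists U, h; split => // z /Hz[].
Qed.

(** If the union were a neighbourhood of some point, then a nearby point off the closed
    set Z would be interior to W. *)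
Lemma dense_setCU n (Z W : set 'rV[C]_n) : analytic_set Z -> analytic_set W ->
  dense (~` Z) -> dense (~` W) -> dense (~` (Z `|` W)).
Proof.
move=> anZ anW dZ dW.
have [a [_ Za]] : setT `&` ~` Z !=set0.
  by apply: dZ; [exists 0|exact: openT].
apply: contrapT => /existsNP [A /not_implyP[[b Ab] /not_implyP[oA noA]]].
have ZWA w : A w -> Z w \/ W w.
  by move=> Aw; apply: contrapT => h; apply: noA; exists w.
have [w [Aw Zw]] : A `&` ~` Z !=set0 by apply: dZ => //; exists b.
have [U [h [[oU Uw] hh HU]]] := anZ w.
have hw : nbhs w [set z | h z != 0].
  have /differentiable_continuous ch := hh w Uw.
  have hw0 : h w != 0 by apply/eqP => h0; apply: Zw; exact/HU.
  exact: (cvgr_neq0 (h w) ch hw0).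
have Ww : nbhs w W.
  apply: filterS3 (open_nbhs_nbhs (conj oU Uw)) (open_nbhs_nbhs (conj oA Aw)) hw.
  by move=> z Uz Az hz; have [/(HU z Uz) /eqP|//] := ZWA z Az; rewrite (negPf hz).
have [x [_ Wx]] : setT `&` ~` W !=set0.
  by apply: dW; [exists 0|exact: openT].
by apply: Wx; exact: (analytic_set_full anW Ww).
Qed.

(** With g1 / h1 and g2 / h2 as local quotients, the denominator h1 h2 vanishes exactly on
    the union of the polar sets. *)
Lemma meromorphic_comb n (f g : merofun R n) (k : C) :
  meromorphic f -> meromorphic g ->
  meromorphic (MeroFun (polar f `|` polar g)
    (fun z => mero_val f z + k * mero_val g z)).
Proof.
move=> mf mg; split.
  by apply: dense_setCU; [exact: polar_analytic..|case: mf|case: mg].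
move=> a; have [U [g1 [h1 [oU hg1 hh1 H1]]]] := mf.2 a.
have [V [g2 [h2 [oV hg2 hh2 H2]]]] := mg.2 a.
exists (U `&` V), (fun z => g1 z * h2 z + k * (g2 z * h1 z)), (fun z => h1 z * h2 z).
have s1 : U `&` V `<=` U by move=> z [].
have s2 : U `&` V `<=` V by move=> z [].
have {}hg1 := holomorphicS s1 hg1; have {}hh1 := holomorphicS s1 hh1.
have {}hg2 := holomorphicS s2 hg2; have {}hh2 := holomorphicS s2 hh2.
split; first exact: open_nbhsI.
- apply: holomorphicD; first exact: holomorphicM.
  by apply: holomorphicM; [exact: holomorphic_cst|exact: holomorphicM].
- exact: holomorphicM.
move=> z [/H1 [[p1 q1] e1] /H2 [[p2 q2] e2]]; split=> /=.
  split; first by move=> [/p1 ->|/p2 ->]; rewrite ?mul0r ?mulr0.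
  by move/eqP; rewrite mulf_eq0 => /orP[/eqP/q1|/eqP/q2]; [left|right].
move=> /not_orP[n1 n2]; rewrite e1// e2//.
have h10 : h1 z != 0 by apply/eqP => /q1.
have h20 : h2 z != 0 by apply/eqP => /q2.
by field; rewrite h10 h20.
Qed.

Lemma meromorphic_add n (f g : merofun R n) : meromorphic f -> meromorphic g ->
  meromorphic (mero_add f g).
Proof.
move=> mf mg; have := meromorphic_comb 1 mf mg.
by congr (meromorphic (MeroFun _ _)); apply/funext => z; rewrite mul1r.
Qed.

Lemma meromorphic_sub n (f g : merofun R n) : meromorphic f -> meromorphic g ->
  meromorphic (mero_sub f g).
Proof.
move=> mf mg; have := meromorphic_comb (-1) mf mg.
by congr (meromorphic (MeroFun _ _)); apply/funext => z; rewrite mulN1r.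
Qed.

Lemma meromorphic_scale n (c : C) (f : merofun R n) : meromorphic f ->
  meromorphic (mero_scale c f).
Proof.
move=> [df H]; split => // a; have [U [g [h [oU hg hh Hz]]]] := H a.
exists U, (fun z => c * g z), h; split => //.
  by apply: holomorphicM => //; exact: holomorphic_cst.
by move=> z /Hz[? e]; split => //= /e ->; rewrite mulrA.
Qed.

Lemma differentiable_row n m (t : n.-tuple ('rV[C]_m -> C)) z :
  (forall i, differentiable (tnth t i) z) ->
  differentiable (fun w => \row_(i < n) tnth t i w : 'rV[C]_n) z.
Proof.
move=> dt; have -> : (fun w => \row_(i < n) tnth t i w) =
    \sum_(i < n) (fun w => tnth t i w *: (delta_mx 0 i : 'rV[C]_n)).
  apply/funext => w; rewrite fct_sumE [LHS]row_sum_delta.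
  by apply: eq_bigr => i _; rewrite mxE.
apply: differentiable_sum => i.
exact: differentiableZl.
Qed.

(** One point w that is mapped off the polar set is enough: the preimage of the polar
    set is analytic and misses w, so it is nowhere dense. *)
Lemma meromorphic_subst n m (f : merofun R n) (t : n.-tuple ('rV[C]_m -> C)) w :
  (forall i z, differentiable (tnth t i) z) -> meromorphic f ->
  ~ polar (mero_subst f t) w -> meromorphic (mero_subst f t).
Proof.
move=> dt [df H] w0; set phi := fun w => \row_(i < n) tnth t i w.
have dphi z : differentiable phi z by apply: differentiable_row => i; exact: dt.
have loc a : exists U (g h : 'rV[C]_m -> C),
    [/\ open_nbhs a U, holomorphic U g, holomorphic U h &
      forall z, U z -> (polar (mero_subst f t) z <-> h z = 0) /\
        (~ polar (mero_subst f t) z -> mero_val (mero_subst f t) z = g z / h z)].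
  have [U [g [h [[oU Ua] hg hh Hz]]]] := H (phi a).
  exists (phi @^-1` U), (g \o phi), (h \o phi); split.
  - split => //; apply: open_comp => // z _.
    exact: differentiable_continuous.
  - by move=> z Uz; apply: differentiable_comp => //; exact: hg.
  - by move=> z Uz; apply: differentiable_comp => //; exact: hh.
  - by move=> z /Hz.
split => //; apply: analytic_set_dense w0.
by move=> a; have [U [g [h [oU _ hh Hz]]]] := loc a; exists U, h; split => // z /Hz[].
Qed.

(** Off the poles, the zeros of a meromorphic function together with its polar
    set are locally the zeros of the product of numerator and denominator. *)
Lemma meromorphic_identity n (f : merofun R n) (a : 'rV[C]_n) : meromorphic f ->
  (\forall z \near a, ~ polar f z -> mero_val f z = 0) ->
  forall z, ~ polar f z -> mero_val f z = 0.
Proof.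
move=> [_ H] near0.
pose Z := [set z | polar f z \/ mero_val f z = 0].
suff ZT : forall z, Z z by move=> z pz; case: (ZT z).
apply: (analytic_set_full (a := a)).
  move=> b; have [U [g [h [oU hg hh Hz]]]] := H b.
  exists U, (fun z => g z * h z); split => //; first exact: holomorphicM.
  move=> z /Hz[[p q] e]; split.
    have [/p -> _|np] := pselect (polar f z); first by rewrite mulr0.
    move=> [//|]; rewrite (e np) => /eqP; rewrite mulf_eq0 invr_eq0.
    by case/orP => /eqP ->; rewrite ?mul0r ?mulr0.
  move/eqP; rewrite mulf_eq0 => /orP[/eqP g0|/eqP/q]; last by left.
  by have [pz|/e ez] := pselect (polar f z); [left|right; rewrite ez g0 mul0r].
apply: filterS near0 => z hz.
by have [pz|/hz] := pselect (polar f z); [left|right].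
Qed.

End Meromorphic.

(** * Unordered sums *)

#[local] Existing Instance summability.totally_filter.

Section Summation.
Variable R : realType.
Local Notation C := R[i]^o.
Local Notation fsum u A := (\sum_(i <- A%fset) u i).

Lemma has_sumP (I : choiceType) (u : I -> C) (l : C) : has_sum u l <->
  forall e : R, 0 < e -> exists A0 : {fset I}, forall A : {fset I}, (A0 `<=` A)%fset ->
    `|l - fsum u A| <= e%:C.
Proof.
have psE A : summability.partial_sum u A = fsum u A.
  by rewrite /summability.partial_sum big_seq_fsetE.
split=> [/cvgrPdist_le H e e0|H].
  have ec : (0 : R[i]) < e%:C by rewrite ltcR.
  have [A0 _ HA] := H _ ec; exists A0 => A /HA.
  by rewrite /= psE.
apply/cvgrPdist_le => _/posc_real[e e0 ->].
have [A0 HA] := H _ e0; exists A0 => // A /HA.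
by rewrite /= psE.
Qed.

Lemma has_sum_unique (I : choiceType) (u : I -> C) (l l' : C) :
  has_sum u l -> has_sum u l' -> l = l'.
Proof. by move=> h h'; apply: (cvg_unique _ h h'). Qed.

Lemma has_sumD (I : choiceType) (u v : I -> C) (l m : C) :
  has_sum u l -> has_sum v m -> has_sum (fun i => u i + v i) (l + m).
Proof.
move=> hu hv; rewrite /has_sum.
have -> : summability.partial_sum (fun i => u i + v i) =
    (fun A => summability.partial_sum u A + summability.partial_sum v A).
  by apply/funext => A; rewrite /summability.partial_sum big_split.
exact: (@cvgD _ C _ summability.totally _ _ _ l m hu hv).
Qed.

Lemma has_sumZ (I : choiceType) (c : C) (u : I -> C) (l : C) :
  has_sum u l -> has_sum (fun i => c * u i) (c * l).
Proof.
move=> hu; rewrite /has_sum.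
have -> : summability.partial_sum (fun i => c * u i) =
    (fun A => c * summability.partial_sum u A).
  by apply/funext => A; rewrite /summability.partial_sum mulr_sumr.
exact: (@cvgMr _ _ summability.totally _ _ c l hu).
Qed.

Lemma has_sum_finite (I : choiceType) (u : I -> C) (A : {fset I}) :
  (forall i, i \notin A -> u i = 0) -> has_sum u (fsum u A).
Proof.
move=> uA; apply/has_sumP => e e0; exists A => B AB.
by rewrite (big_fset_incl _ AB) ?subrr ?normr0 ?ler0c ?ltW// => i _; exact: uA.
Qed.

(** Summation by packets. The sums of the packets are given, so only finite
    approximations have to be compared. *)
Lemma has_sum_fiber (I K : choiceType) (phi : I -> K) (u : I -> C) (v : K -> C) (l : C) :
  has_sum u l ->
  (forall k, has_sum (fun i => if phi i == k then u i else 0) (v k)) ->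
  has_sum v l.
Proof.
move=> /has_sumP hu hv; apply/has_sumP => e e0.
have e20 : 0 < e / 2 by rewrite divr_gt0.
have [A0 HA0] := hu _ e20.
exists [fset phi i | i in A0]%fset => B AB.
pose d := e / 2 / (#|` B|%:R + 1).
have d0 : 0 < d by rewrite divr_gt0// ltr_wpDl.
have /choice[J HJ] : forall k, exists J : {fset I}, forall A, (J `<=` A)%fset ->
    `|v k - fsum (fun i => if phi i == k then u i else 0) A| <= d%:C.
  by move=> k; have /has_sumP := hv k; exact.
(* a finite set of indices that contains A0, lies over B and is large enough in
   each of the fibres over B *)
pose A1 := (A0 `|` \bigcup_(k <- B) J k)%fset.
pose A := [fset i in A1 | phi i \in B]%fset.
have A0A : (A0 `<=` A)%fset.
  apply/fsubsetP => i iA; rewrite !inE/= iA/=.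
  by apply: (fsubsetP AB); exact: in_imfset.
have sumA : fsum u A = \sum_(k <- B) fsum (fun i => if phi i == k then u i else 0) A1.
  rewrite exchange_big/=.
  rewrite /A big_fset/=; rewrite [LHS]big_mkcond/=; apply: eq_bigr => i _.
  case: ifPn => iB.
    rewrite (big_fsetD1 (phi i))//= eqxx big1_fset ?addr0// => k.
    by rewrite !inE => /andP[/negPf + _ _]; rewrite eq_sym => ->.
  rewrite big1_fset// => k kB _; case: eqP => // E.
  by move: iB; rewrite E kB.
have -> : l - fsum v B = (l - fsum u A) + (fsum u A - fsum v B).
  by rewrite addrA subrK.
apply: (le_trans (ler_normD _ _)).
have -> : e%:C = (e / 2)%:C + (e / 2)%:C :> R[i] by rewrite -rmorphD -splitr.
apply: lerD; first exact: HA0.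
rewrite sumA -sumrB; apply: (le_trans (ler_norm_sum _ _ _)).
apply: (@le_trans _ _ (\sum_(k <- B) d%:C)).
  rewrite big_seq [leRHS]big_seq; apply: ler_sum => k kB.
  rewrite distrC; apply: HJ; apply: (fsubset_trans _ (fsubsetUr _ _)).
  exact: bigfcup_sup.
rewrite big_const_seq iter_addr_0 count_predT -rmorphMn lecR -mulr_natr /d.
rewrite mulrAC ler_pdivrMr ?ltr_wpDl//; apply: ler_wpM2l; first exact: ltW.
by rewrite lerDl.
Qed.

(** A special case of summation by packets, with at most one index in each packet. *)
Lemma has_sum_inj (I J : choiceType) (f : J -> I) (w : J -> C) (u : I -> C) (s : C) :
  injective f -> (forall j, u (f j) = w j) ->
  (forall i, (forall j, f j <> i) -> u i = 0) -> has_sum w s -> has_sum u s.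
Proof.
move=> injf uf u0 hw; apply: (has_sum_fiber (phi := f) hw) => i.
have [[j <-]|nj] := pselect (exists j, f j = i).
  have := @has_sum_finite J (fun j' => if f j' == f j then w j' else 0) [fset j]%fset.
  rewrite big_seq_fset1 eqxx uf; apply => k; rewrite inE => kj.
  by rewrite (inj_eq injf) (negPf kj).
have -> : (fun j => if f j == i then w j else 0) = (fun=> 0).
  by apply/funext => j; case: eqP => // E; case: nj; exists j.
rewrite u0; last by move=> j E; apply: nj; exists j.
by have := @has_sum_finite J (fun=> 0) fset0; rewrite big_seq_fset0; apply.
Qed.

Lemma mem_fset_iota m n : (m \in [fset i in iota 0 n]%fset) = (m < n)%N.
Proof. by rewrite !inE mem_iota. Qed.

Lemma fsum_iota (V : zmodType) (w : nat -> V) n :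
  \sum_(m <- [fset m in iota 0 n]%fset) w m = \sum_(m < n) w m.
Proof.
rewrite -(big_mkord xpredT w) /index_iota subn0; apply: perm_big.
by apply: uniq_perm; rewrite ?fset_uniq ?iota_uniq// => m; rewrite inE.
Qed.

Lemma ler_fsum (I : choiceType) (a : I -> R) (A B : {fset I}) :
  (forall i, 0 <= a i) -> (A `<=` B)%fset -> fsum a A <= fsum a B.
Proof.
move=> a0 AB; rewrite (big_fsetID _ (mem A) B)/=.
have -> : [fset x in B | x \in A]%fset = A.
  apply/fsetP => i; rewrite !inE /=; apply: andb_idl.
  exact: (fsubsetP AB).
by rewrite lerDl sumr_ge0.
Qed.

Lemma has_sum_range (w : nat -> C) (n : nat) : (forall m, (n <= m)%N -> w m = 0) ->
  has_sum w (\sum_(m < n) w m).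
Proof.
move=> w0.
have -> : \sum_(m < n) w m = fsum w [fset m in iota 0 n]%fset.
  by rewrite fsum_iota.
apply: has_sum_finite => m; rewrite mem_fset_iota -leqNgt; exact: w0.
Qed.

Lemma has_sum_ge0 (a : nat -> R) (l : R) : (forall m, 0 <= a m) ->
  (fun n => \sum_(m < n) a m) @ \oo --> l ->
  has_sum (fun m => (a m)%:C : C) (l%:C : C).
Proof.
move=> a0 cv.
have nd : nondecreasing_seq (fun n => \sum_(m < n) a m).
  by apply/nondecreasing_seqP => n; rewrite big_ord_recr/= lerDl.
have le_l n : \sum_(m < n) a m <= l.
  by have := nondecreasing_cvgn_le nd (cvgP _ cv) n; rewrite (cvg_lim _ cv).
apply/has_sumP => e e0.
have /cvgrPdist_le/(_ _ e0)[n _ Hn] := cv.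
exists [fset m in iota 0 n]%fset => A nA.
rewrite -rmorph_sum -rmorphB norm_real_complex lecR.
pose N := (\max_(m <- A) m).+1.
have AN : \sum_(m <- A) a m <= \sum_(m < N) a m.
  rewrite -fsum_iota ler_fsum//; apply/fsubsetP => m mA.
  by rewrite mem_fset_iota ltnS (leq_bigmax_seq (F := id)).
have nAs : \sum_(m < n) a m <= \sum_(m <- A) a m by rewrite -fsum_iota ler_fsum.
have := Hn n (leqnn n); rewrite !ger0_norm ?subr_ge0 ?le_l//; last first.
  exact: le_trans AN (le_l _).
by apply: le_trans; rewrite lerD2l lerN2.
Qed.

End Summation.

(** * The sum of the inverse squares *)

Section Basel.
Variable R : realType.

Lemma sin_bounds (x : R) : 0 < x < pi / 2 -> x * cos x <= sin x <= x.
Proof.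
move=> /andP[x0 xpi]; apply/andP; split.
  have d (t : R) : is_derive t 1 (fun t : R => sin t - t * cos t) (t * sin t).
    by apply: is_derive_eq; rewrite /GRing.scale/=; ring.
  have [t /andP[t0 tx]] := mean_value (ltW x0) (fun t _ => d t).
  rewrite sin0 mul0r !subr0 -subr_ge0 => ->.
  rewrite mulr_ge0// ?(ltW x0)// mulr_ge0// sin_ge0_pi// t0/=; have := pi_ge2 R; lra.
have [t /andP[t0 tx]] := mean_value (ltW x0) (fun t _ => is_derive_sin t).
by rewrite sin0 !subr0 => ->; rewrite ler_piMl ?cos_le1// ltW.
Qed.

(** The upper bound is 1 / sin^2 x = 1 + cos^2 x / sin^2 x combined with x cos x <= sin x. *)
Lemma inv_sqr_bounds (x : R) : 0 < x < pi / 2 ->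
  x ^- 2 <= sin x ^- 2 <= x ^- 2 + 1.
Proof.
move=> xx; have /andP[h1 h2] := sin_bounds xx; have /andP[x0 xpi] := xx.
have s0 : 0 < sin x by exact: sin_gt0_pihalf.
have c0 : 0 < cos x by apply: cos_gt0_pihalf; rewrite xpi andbT; lra.
apply/andP; split.
  by rewrite lef_pV2 ?posrE ?exprn_gt0// ler_sqr// ?nnegrE ltW.
have sc : 1 = sin x ^+ 2 + cos x ^+ 2 by rewrite addrC cos2Dsin2.
rewrite -(mul1r (sin x ^- 2)) {1}sc mulrDl mulfV ?expf_neq0 ?gt_eqF//.
rewrite addrC lerD2r ler_pdivrMr ?exprn_gt0// mulrC ler_pdivlMr ?exprn_gt0//.
by rewrite -exprMn ler_sqr ?nnegrE ?(ltW s0) 1?mulrC// mulr_ge0 ?(ltW x0) ?(ltW c0).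
Qed.

(** The midpoints of the division of the interval from 0 to pi / 2 in [2 ^ n] parts. *)
Definition angle (n k : nat) : R := (2 * k%:R + 1) * pi / (4 * 2 ^+ n).

Lemma angle_itv n k : (k < 2 ^ n)%N -> 0 < angle n k < pi / 2.
Proof.
move=> kn; have N0 : 0 < 4 * 2 ^+ n :> R by rewrite mulr_gt0// exprn_gt0.
have k0 : 0 <= k%:R :> R by exact: ler0n.
have pi0 := pi_gt0 R.
have kN : k%:R + 1 <= 2 ^+ n :> R by rewrite natr1 -natrX ler_nat.
have a0 : 0 < 2 * k%:R + 1 :> R by lra.
apply/andP; split; first by rewrite divr_gt0 ?mulr_gt0.
rewrite ltr_pdivrMr//; nra.
Qed.

(** Halving the angle: the angle t of the finer division and its complement pi / 2 - t
    contribute 1 / sin^2 t + 1 / cos^2 t = 4 / sin^2 (2 t), and 2 t runs over the angles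
    of the coarser division. *)
Lemma sum_inv_sin2 n : \sum_(k < 2 ^ n) sin (angle n k) ^- 2 = 2 * (2 ^+ n) ^+ 2.
Proof.
elim: n => [|n IH].
  rewrite expn0 big_ord1 /angle mulr0 add0r mul1r expr0 mulr1 expr1n mulr1.
  have c0 : cos (pi / 4 + pi / 4) = 0 :> R.
    by rewrite (_ : pi / 4 + pi / 4 = pi / 2) ?cos_pihalf//; field.
  have : sin (pi / 4) ^+ 2 = 2^-1 :> R.
    have := cos2Dsin2 (pi / 4 : R); move: c0; rewrite cosD -!expr2; lra.
  by move=> ->; rewrite invrK.
have -> : 2 * (2 ^+ n.+1) ^+ 2 = 4 * (2 * (2 ^+ n) ^+ 2) :> R by rewrite (exprS _ n); ring.
rewrite -IH expnS mul2n -addnn big_split_ord/=.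
rewrite [X in _ + X](reindex_inj rev_ord_inj)/= -big_split/= mulr_sumr.
apply: eq_bigr => -[i iN] _ /=.
set t := angle n.+1 i.
have N0 : 2 ^+ n != 0 :> R by rewrite expf_neq0.
have -> : angle n.+1 (2 ^ n + (2 ^ n - i.+1)) = pi / 2 - t.
  rewrite /t /angle natrD natrB// natrX -natr1 (exprS _ n); field; exact: N0.
have -> : angle n i = t + t by rewrite /t /angle (exprS _ n); field; exact: N0.
have tt : 0 < t < pi / 2.
  by apply: angle_itv; rewrite expnS mul2n -addnn ltn_addr.
have s0 : sin t != 0 by rewrite gt_eqF// sin_gt0_pihalf.
have c0 : cos t != 0.
  by rewrite gt_eqF// cos_gt0_pihalf//; case/andP: tt => ? ->; rewrite andbT; have := pi_gt0 R; lra.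
rewrite sinB cos_pihalf mul0r subr0 sin_pihalf mul1r sinD.
have sc := cos2Dsin2 t.
have -> : sin t * cos t + cos t * sin t = 2 * (sin t * cos t) by ring.
have -> : sin t ^- 2 + cos t ^- 2 =
  (cos t ^+ 2 + sin t ^+ 2) / (sin t * cos t) ^+ 2 by field; rewrite s0 c0.
by rewrite sc; field; rewrite s0 c0.
Qed.

Definition harm (n : nat) : R := \sum_(k < n) (k.+1%:R)^-1.
Definition harm2 (n : nat) : R := \sum_(k < n) k.+1%:R ^- 2.

Lemma harmS n : harm n.+1 = harm n + (n.+1%:R)^-1.
Proof. by rewrite /harm big_ord_recr. Qed.

Lemma harm2S n : harm2 n.+1 = harm2 n + n.+1%:R ^- 2.
Proof. by rewrite /harm2 big_ord_recr. Qed.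

Let odd_sum n : R := \sum_(k < n) (2 * k%:R + 1) ^- 2.

Let harm2_double n : harm2 (n + n) = odd_sum n + harm2 n / 4.
Proof.
elim: n => [|n IH]; first by rewrite /harm2 /odd_sum !big_ord0; ring.
rewrite addSn addnS !harm2S IH /odd_sum big_ord_recr/=.
have n0 : 0 <= n%:R :> R by exact: ler0n.
have h1 : 2 * n%:R + 1 != 0 :> R by rewrite gt_eqF//; lra.
have h2 : n%:R + 1 != 0 :> R by rewrite gt_eqF//; lra.
have -> : (n + n).+2%:R = 2 * (n%:R + 1) :> R.
  by rewrite -addnS -addSn natrD -natr1; ring.
have -> : (n + n).+1%:R = 2 * n%:R + 1 :> R by rewrite -natr1 natrD; ring.
by rewrite -natr1; field; rewrite h1 addrC h2.
Qed.

Let odd_sum_bounds n :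
  pi ^+ 2 / 8 - pi ^+ 2 / 16 / 2 ^+ n <= odd_sum (2 ^ n) <= pi ^+ 2 / 8.
Proof.
pose N : R := 2 ^+ n.
have N0 : 0 < N by rewrite exprn_gt0.
have pi0 := pi_gt0 R.
have E : \sum_(k < 2 ^ n) angle n k ^- 2 = 16 * N ^+ 2 / pi ^+ 2 * odd_sum (2 ^ n).
  rewrite /odd_sum mulr_sumr; apply: eq_bigr => -[k kn] _ /=.
  rewrite /angle -/N; field.
  have k0 : 0 <= k%:R :> R by exact: ler0n.
  by rewrite !gt_eqF//; lra.
have u : 16 * N ^+ 2 / pi ^+ 2 * odd_sum (2 ^ n) <= 2 * N ^+ 2.
  rewrite -E -sum_inv_sin2; apply: ler_sum => -[k kn] _ /=.
  by case/andP: (inv_sqr_bounds (angle_itv kn)).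
have l : 2 * N ^+ 2 <= 16 * N ^+ 2 / pi ^+ 2 * odd_sum (2 ^ n) + N.
  rewrite -E -sum_inv_sin2 /N -natrX.
  have -> : (2 ^ n)%:R = \sum_(k < 2 ^ n) 1 :> R by rewrite sumr_const card_ord.
  rewrite -big_split/=; apply: ler_sum => -[k kn] _ /=.
  by case/andP: (inv_sqr_bounds (angle_itv kn)).
have c0 : 0 < 16 * N ^+ 2 / pi ^+ 2 by rewrite !mulr_gt0 ?invr_gt0 ?exprn_gt0.
rewrite -/N; move: pi0 u l c0 {E}; move: (pi : R) => p p0 u l c0.
apply/andP; split; rewrite -(ler_pM2l c0).
  have -> : 16 * N ^+ 2 / p ^+ 2 * (p ^+ 2 / 8 - p ^+ 2 / 16 / N) = 2 * N ^+ 2 - N.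
    by field; rewrite (lt0r_neq0 N0) (lt0r_neq0 p0).
  by rewrite lerBlDr.
have -> // : 16 * N ^+ 2 / p ^+ 2 * (p ^+ 2 / 8) = 2 * N ^+ 2.
by field; rewrite gt_eqF.
Qed.

Lemma expn2_cvgn : (fun n => 2 ^ n)%N @ \oo --> \oo.
Proof.
apply/cvgnyPge => A; near=> n.
apply: (@leq_trans n); last by rewrite ltnW// ltn_expl.
by near: n; exact: nbhs_infty_ge.
Unshelve. all: by end_near. Qed.

(** Half of the terms of a partial sum of length [2 N], those with even
    denominator, form a quarter of the partial sum of length [N]. *)
Lemma harm2_cvg : harm2 @ \oo --> (pi ^+ 2 / 6 : R).
Proof.
have nd : nondecreasing_seq harm2.
  by apply/nondecreasing_seqP => n; rewrite harm2S lerDl invr_ge0 exprn_ge0.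
have pow_le n : harm2 (2 ^ n) <= pi ^+ 2 / 6.
  elim: n => [|n IH].
    have /andP[_] := odd_sum_bounds 0; rewrite expn0 /harm2 /odd_sum !big_ord1.
    rewrite mulr0 add0r expr1n invr1; have := sqr_ge0 (pi : R); lra.
  rewrite expnS mul2n -addnn harm2_double.
  have /andP[_ h] := odd_sum_bounds n; lra.
have cv : cvgn harm2.
  apply: nondecreasing_is_cvgn => //; exists (pi ^+ 2 / 6) => _ [n _ <-].
  by apply: le_trans (pow_le n); apply: nd; rewrite ltnW// ltn_expl.
have sub : (harm2 (2 ^ n)%N @[n --> \oo]) --> limn harm2.
  exact: (cvg_comp _ _ expn2_cvgn cv).
have geo : (pi ^+ 2 / 16 / 2 ^+ n : R) @[n --> \oo] --> (0 : R).
  rewrite -[X in _ --> X](mulr0 (pi ^+ 2 / 16)); apply: cvgM; first exact: cvg_cst.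
  under eq_fun do rewrite -exprVn.
  by apply: cvg_expr; rewrite ger0_norm ?invr_ge0// invf_lt1 ?ltr1n.
have odd_cvg : odd_sum (2 ^ n)%N @[n --> \oo] --> (pi ^+ 2 / 8 : R).
  apply: (@squeeze_cvgr _ _ _ _ (fun n => pi ^+ 2 / 8 - pi ^+ 2 / 16 / 2 ^+ n)
     (fun=> pi ^+ 2 / 8)).
  - by near=> n; exact: odd_sum_bounds.
  - by rewrite -[X in _ --> X]subr0; apply: cvgB => //; exact: cvg_cst.
  - exact: cvg_cst.
have shift : harm2 (2 ^ n.+1)%N @[n --> \oo] --> limn harm2.
  by rewrite (cvg_shiftS (fun n => harm2 (2 ^ n)%N)).
have : harm2 (2 ^ n.+1)%N @[n --> \oo] --> pi ^+ 2 / 8 + limn harm2 / 4.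
  have -> : (fun n => harm2 (2 ^ n.+1)%N) =
     (fun n => odd_sum (2 ^ n)%N + harm2 (2 ^ n)%N / 4).
    by apply/funext => n; rewrite expnS mul2n -addnn harm2_double.
  by apply: cvgD => //; apply: cvgM => //; exact: cvg_cst.
move=> /(cvg_unique (@norm_hausdorff _ R) shift) E.
have -> : pi ^+ 2 / 6 = limn harm2.
  move: E; move: (pi ^+ 2) (limn harm2) => p l E; lra.
exact: cv.
Unshelve. all: by end_near. Qed.

End Basel.

(** * The coefficient identity *)

Section Coefficients.
Variable R : realType.
Local Notation harm := (@harm R).
Local Notation harm2 := (@harm2 R).

Lemma sum_inv_shift (a n : nat) :
  \sum_(m < n) ((a + m.+1)%:R)^-1 = harm (a + n) - harm a :> R.
Proof.
elim: n => [|n IH]; first by rewrite big_ord0 addn0 subrr.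
by rewrite big_ord_recr/= IH addnS harmS; ring.
Qed.

Lemma sum_inv_shift2 (a n : nat) :
  \sum_(m < n) (a + m.+1)%:R ^- 2 = harm2 (a + n) - harm2 a :> R.
Proof.
elim: n => [|n IH]; first by rewrite big_ord0 addn0 subrr.
by rewrite big_ord_recr/= IH addnS harm2S; ring.
Qed.

Lemma sum_inv_refl (a n : nat) : (n < a)%N ->
  \sum_(m < n) (a%:R - m.+1%:R)^-1 = harm a.-1 - harm (a.-1 - n) :> R.
Proof.
case: a => // a; rewrite ltnS /=; elim: n => [|n IH] na.
  by rewrite big_ord0 subn0 subrr.
rewrite big_ord_recr/= IH ?(ltnW na)//.
have -> : a.+1%:R - n.+1%:R = (a - n)%:R :> R by rewrite -natrB ?subSS// ltnW.
by rewrite -(subnSK na) harmS; ring.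
Qed.

Lemma sum_inv_refl2 (a n : nat) : (n < a)%N ->
  \sum_(m < n) (a%:R - m.+1%:R) ^- 2 = harm2 a.-1 - harm2 (a.-1 - n) :> R.
Proof.
case: a => // a; rewrite ltnS /=; elim: n => [|n IH] na.
  by rewrite big_ord0 subn0 subrr.
rewrite big_ord_recr/= IH ?(ltnW na)//.
have -> : a.+1%:R - n.+1%:R = (a - n)%:R :> R by rewrite -natrB ?subSS// ltnW.
by rewrite -(subnSK na) harm2S; ring.
Qed.

Lemma harm_shift_cvg (a : nat) : (harm (a + n)%N - harm n) @[n --> \oo] --> (0 : R).
Proof.
elim: a => [|a IH].
  under eq_fun do rewrite add0n subrr; exact: cvg_cst.
have -> : (fun n => harm (a.+1 + n)%N - harm n) =
    (fun n => (harm (a + n)%N - harm n) + ((n + a).+1%:R)^-1).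
  by apply/funext => n; rewrite addSn harmS (addnC n); ring.
rewrite -[X in _ --> X]addr0; apply: cvgD => //.
by have := @cvg_harmonic R; rewrite -(cvg_shiftn a).
Qed.

Definition series_term (p q m : nat) : R :=
  (m.+1%:R * (p + m.+1)%:R * (q + m.+1)%:R * (p + q + m.+1)%:R)^-1.

(** The value of the series of [series_term], by partial fractions. For p = q the double
    pole at - p brings in the sum of the inverse squares. *)
Definition series_coef (p q : nat) : R :=
  if p == q then harm (p + p) / (2 * p%:R ^+ 3) - (pi ^+ 2 / 6 - harm2 p) / p%:R ^+ 2
  else (harm p - harm q) / (p%:R * q%:R * (q%:R - p%:R)) +
    harm (p + q) / (p%:R * q%:R * (p%:R + q%:R)).

Lemma series_term_ge0 p q m : 0 <= series_term p q m.
Proof. by rewrite invr_ge0 !mulr_ge0. Qed.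

Lemma natr_neq0 n : (0 < n)%N -> n%:R != 0 :> R.
Proof. by rewrite pnatr_eq0 lt0n. Qed.

Lemma natrB_neq0 m n : m != n -> m%:R - n%:R != 0 :> R.
Proof. by rewrite subr_eq0 eqr_nat. Qed.

Lemma series_coef_cvg p q : (0 < p)%N -> (0 < q)%N ->
  (fun n => \sum_(m < n) series_term p q m) @ \oo --> series_coef p q.
Proof.
move=> p0 q0; have P0 := natr_neq0 p0; have Q0 := natr_neq0 q0.
have PQ0 : p%:R + q%:R != 0 :> R by rewrite -natrD natr_neq0// addn_gt0 p0.
rewrite /series_coef; case: eqVneq => [E|pq].
  rewrite -E in Q0 PQ0 *; move=> {E q q0}.
  have -> : (fun n => \sum_(m < n) series_term p p m) = (fun n =>
      (harm (p + p) - (harm (p + p + n)%N - harm n)) / (2 * p%:R ^+ 3)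
      - (harm2 (n + p)%N - harm2 p) / p%:R ^+ 2).
    apply/funext => n; rewrite (addnC n) -sum_inv_shift2.
    have -> : harm (p + p) - (harm (p + p + n)%N - harm n) =
        harm n - \sum_(m < n) ((p + p + m.+1)%:R)^-1 by rewrite sum_inv_shift; ring.
    rewrite /harm -sumrB !mulr_suml -sumrB; apply: eq_bigr => m _.
    rewrite /series_term !natrD; have M0 := natr_neq0 (ltn0Sn m).
    have h1 : p%:R + m.+1%:R != 0 :> R by rewrite -natrD natr_neq0// addn_gt0 p0.
    have h2 : p%:R + p%:R + m.+1%:R != 0 :> R.
      by rewrite -!natrD natr_neq0// !addn_gt0 p0.
    move: h1 h2 M0; move: (m.+1%:R) => M h1 h2 M0.
    by field; rewrite P0 M0 h1 h2.
  apply: cvgB; apply: cvgM; try exact: cvg_cst.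
    rewrite -[X in _ --> X]subr0; apply: cvgB; first exact: cvg_cst.
    exact: harm_shift_cvg.
  apply: cvgB; last exact: cvg_cst.
  by rewrite (cvg_shiftn p); exact: harm2_cvg.
have QP0 : q%:R - p%:R != 0 :> R by rewrite natrB_neq0// eq_sym.
pose D a n := harm (a + n)%N - harm n.
have -> : (fun n => \sum_(m < n) series_term p q m) = (fun n =>
    ((harm p - harm q) - (D p n - D q n)) / (p%:R * q%:R * (q%:R - p%:R))
    + (harm (p + q) - D (p + q)%N n) / (p%:R * q%:R * (p%:R + q%:R))).
  apply/funext => n.
  have E1 : (harm p - harm q) - (D p n - D q n) =
    \sum_(m < n) (((q + m.+1)%:R)^-1 - ((p + m.+1)%:R)^-1).
    by rewrite sumrB !sum_inv_shift /D; ring.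
  have E2 : harm (p + q) - D (p + q)%N n =
    \sum_(m < n) ((m.+1%:R)^-1 - ((p + q + m.+1)%:R)^-1).
    by rewrite sumrB !sum_inv_shift /D -/(harm n); ring.
  rewrite E1 E2 !mulr_suml -big_split/=; apply: eq_bigr => m _.
  rewrite /series_term !natrD; have M0 := natr_neq0 (ltn0Sn m).
  have h1 : p%:R + m.+1%:R != 0 :> R by rewrite -natrD natr_neq0// addn_gt0 p0.
  have h2 : q%:R + m.+1%:R != 0 :> R by rewrite -natrD natr_neq0// addn_gt0 q0.
  have h3 : p%:R + q%:R + m.+1%:R != 0 :> R.
    by rewrite -!natrD natr_neq0// !addn_gt0 p0.
  move: h1 h2 h3 M0; move: (m.+1%:R) => M h1 h2 h3 M0.
  by field; rewrite P0 Q0 M0 h1 h2 h3 PQ0 QP0.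
apply: cvgD; apply: cvgM; try exact: cvg_cst.
  rewrite -[X in _ --> X]subr0; apply: cvgB; first exact: cvg_cst.
  by rewrite -(subr0 0); apply: cvgB; exact: harm_shift_cvg.
rewrite -[X in _ --> X]subr0; apply: cvgB; first exact: cvg_cst.
exact: harm_shift_cvg.
Qed.

(** The terms 1 / (m (m + p) (m + q) (m + p + q)) for m between - min (p, q) and 0, up to
    the sign. *)
Definition inner_term (p q m : nat) : R :=
  (m.+1%:R * (p - m.+1)%:R * (q - m.+1)%:R * (p + q - m.+1)%:R)^-1.

Definition inner_coef (p q : nat) : R := \sum_(m < (minn p q).-1) inner_term p q m.

Lemma inner_coefC p q : inner_coef p q = inner_coef q p.
Proof.
rewrite /inner_coef minnC; apply: eq_bigr => m _; rewrite /inner_term (addnC p).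
by congr (_^-1); ring.
Qed.

(** The terms 1 / (m (m + p) (m + q) (m + p + q)) for m strictly between - p and - q. *)
Definition gap_term (p q m : nat) : R :=
  (m.+1%:R * (p - q - m.+1)%:R * (q + m.+1)%:R * (p - m.+1)%:R)^-1.

Definition gap_coef (p q : nat) : R := \sum_(m < (p - q).-1) gap_term p q m.

Lemma harm0 : harm 0 = 0. Proof. by rewrite /harm big_ord0. Qed.
Lemma harm20 : harm2 0 = 0. Proof. by rewrite /harm2 big_ord0. Qed.

Lemma natrB_lt (a m : nat) : (m < a)%N ->
  (a - m)%:R = a%:R - m%:R :> R /\ a%:R - m%:R != 0 :> R.
Proof.
by move=> ma; rewrite natrB ?(ltnW ma)//; split => //; rewrite natrB_neq0 ?gtn_eqF.
Qed.

Lemma inner_coef_lt p d : (0 < p)%N -> (0 < d)%N ->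
  inner_coef p (p + d) =
   (harm p.-1 + harm (p + (p + d)).-1 - harm (p + d)) /
     (p%:R * (p + d)%:R * (p%:R + (p + d)%:R)) +
   (harm p.-1 - harm (p + d).-1 + harm d) / (p%:R * (p + d)%:R * d%:R).
Proof.
move=> p0 d0; set q := (p + d)%N.
have q0 : (0 < q)%N by rewrite addn_gt0 p0.
have pq : (p < q)%N by rewrite -addn1 leq_add2l.
have pp : (p.-1 < p)%N by rewrite prednK.
have P0 := natr_neq0 p0; have Q0 := natr_neq0 q0; have D0 := natr_neq0 d0.
have PQ0 : p%:R + q%:R != 0 :> R by rewrite -natrD natr_neq0// addn_gt0 p0.
have -> : harm p.-1 + harm (p + q).-1 - harm q =
  \sum_(m < p.-1) ((m.+1%:R)^-1 + ((p + q)%:R - m.+1%:R)^-1).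
  rewrite big_split/= sum_inv_refl; last by rewrite ltn_addr.
  have -> : ((p + q).-1 - p.-1)%N = q by case: (p) p0 => // p' _; rewrite addSn/= addKn.
  by rewrite -/(harm _); ring.
have -> : harm p.-1 - harm q.-1 + harm d =
  \sum_(m < p.-1) ((p%:R - m.+1%:R)^-1 - (q%:R - m.+1%:R)^-1).
  rewrite sumrB !sum_inv_refl//; last by rewrite (ltn_trans pp).
  have -> : (q.-1 - p.-1)%N = d by rewrite /q; case: (p) p0 => // p' _; rewrite addSn/= addKn.
  by rewrite subnn harm0; ring.
rewrite !mulr_suml -big_split/= /inner_coef (minn_idPl _) ?(ltnW pq)//.
apply: eq_bigr => -[m mp] _ /=; rewrite /inner_term.
have mp' : (m.+1 < p)%N by rewrite -(prednK p0) ltnS.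
have mq' := ltn_trans mp' pq.
have [-> h1] := natrB_lt mp'; have [-> h2] := natrB_lt mq'.
have [-> h3] := natrB_lt (ltn_addr q mp').
have M0 := natr_neq0 (ltn0Sn m).
have -> : d%:R = q%:R - p%:R :> R by rewrite /q natrD; ring.
have QP : q%:R - p%:R != 0 :> R by rewrite natrB_neq0// gtn_eqF.
move: h3; rewrite natrD => h3.
move: h1 h2 h3 M0; move: (m.+1%:R) => M h1 h2 h3 M0.
by field; rewrite P0 Q0 M0 h1 h2 h3 PQ0 QP.
Qed.

Lemma inner_coef_diag p : (0 < p)%N ->
  inner_coef p p = (harm p.-1 + harm (p + p).-1 - harm p) / (2 * p%:R ^+ 3)
     + harm2 p.-1 / p%:R ^+ 2.
Proof.
move=> p0; have P0 := natr_neq0 p0.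
have pp : (p.-1 < p)%N by rewrite prednK.
have -> : harm p.-1 + harm (p + p).-1 - harm p =
  \sum_(m < p.-1) ((m.+1%:R)^-1 + ((p + p)%:R - m.+1%:R)^-1).
  rewrite big_split/= sum_inv_refl; last by rewrite ltn_addr.
  have -> : ((p + p).-1 - p.-1)%N = p by case: (p) p0 => // p' _; rewrite addSn/= addKn.
  by rewrite -/(harm _); ring.
have -> : harm2 p.-1 = \sum_(m < p.-1) (p%:R - m.+1%:R) ^- 2.
  by rewrite sum_inv_refl2// subnn harm20 subr0.
rewrite !mulr_suml -big_split/= /inner_coef minnn.
apply: eq_bigr => -[m mp] _ /=; rewrite /inner_term.
have mp' : (m.+1 < p)%N by rewrite -(prednK p0) ltnS.
have [-> h1] := natrB_lt mp'.
have [-> h3] := natrB_lt (ltn_addr p mp').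
have M0 := natr_neq0 (ltn0Sn m).
move: h3; rewrite natrD => h3.
move: h1 h3 M0; move: (m.+1%:R) => M h1 h3 M0.
by field; rewrite P0 M0 h1 h3.
Qed.

Lemma gap_coef_lt p d : (0 < p)%N -> (0 < d)%N ->
  gap_coef (p + d) p = 2 * harm d.-1 / (d%:R * p%:R * (p + d)%:R)
    - 2 * (harm (p + d).-1 - harm p) / (p%:R * (p + d)%:R * (p%:R + (p + d)%:R)).
Proof.
move=> p0 d0; set q := (p + d)%N.
have q0 : (0 < q)%N by rewrite addn_gt0 p0.
have P0 := natr_neq0 p0; have Q0 := natr_neq0 q0; have D0 := natr_neq0 d0.
have PQ0 : p%:R + q%:R != 0 :> R by rewrite -natrD natr_neq0// addn_gt0 p0.
have dd : (d.-1 < d)%N by rewrite prednK.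
have dq : (d.-1 < q)%N by rewrite (leq_trans dd)// leq_addl.
have -> : 2 * harm d.-1 = \sum_(m < d.-1) ((m.+1%:R)^-1 + (d%:R - m.+1%:R)^-1).
  by rewrite big_split/= sum_inv_refl// subnn harm0 -/(harm _); ring.
have qd : (q.-1 - d.-1)%N = p.
  by rewrite /q; case: (d) d0 => // d' _; rewrite addnS/= addnK.
have -> : 2 * (harm q.-1 - harm p) =
  \sum_(m < d.-1) (((p + m.+1)%:R)^-1 + (q%:R - m.+1%:R)^-1).
  rewrite big_split/= sum_inv_refl// sum_inv_shift qd.
  have -> : (p + d.-1)%N = q.-1 by rewrite /q; case: (d) d0 => // d' _; rewrite addnS.
  by ring.
rewrite !mulr_suml -sumrB /gap_coef /q addKn.
apply: eq_bigr => -[m md] _ /=; rewrite /gap_term addKn -/q.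
have md' : (m.+1 < d)%N by rewrite -(prednK d0) ltnS.
have [-> h1] := natrB_lt md'.
have [-> h2] := natrB_lt (ltn_addl p md').
have M0 := natr_neq0 (ltn0Sn m).
have QP : q%:R - p%:R = d%:R :> R by rewrite /q natrD; ring.
have h3 : p%:R + m.+1%:R != 0 :> R by rewrite -natrD natr_neq0// addn_gt0 p0.
move: h1 h2 PQ0 Q0; rewrite !natrD => h1 h2 PQ0 Q0.
move: h1 h2 h3 M0; move: (m.+1%:R) => M h1 h2 h3 M0.
by field; rewrite P0 Q0 M0 h1 h2 h3 PQ0 D0.
Qed.

Lemma gap_coef0 p q : (p <= q)%N -> gap_coef p q = 0.
Proof. by rewrite /gap_coef -subn_eq0 => /eqP ->; rewrite big_ord0. Qed.

(** The coefficients of the nine double zeta series and of the two zeta series on the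
    right-hand side, in this order. *)
Definition double_coef (p q : nat) : R :=
  let P : R := p%:R in let Q : R := q%:R in
  2 * ((P ^+ 2 * Q * (P + Q))^-1
       + (if (p < q)%N then (P ^+ 2 * Q * (Q - P))^-1 else 0)
       - (if (q < p)%N then (Q * P ^+ 2 * (P - Q))^-1 else 0)
       - (if (p < q)%N then (P * Q ^+ 2 * (Q - P))^-1 else 0)
       + (if (q < p)%N then (Q ^+ 2 * P * (P - Q))^-1 else 0)
       + (P * Q ^+ 2 * (P + Q))^-1
       - (if (p < q)%N then (P * Q * (Q - P) ^+ 2)^-1 else 0)
       - (if (q < p)%N then (Q * P * (P - Q) ^+ 2)^-1 else 0)
       + (P * Q * (P + Q) ^+ 2)^-1)
  + (if p == q then P ^- 4 else 0)
  - pi ^+ 2 / 3 * (if p == q then P ^- 2 else 0).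

Lemma series_coefC p q : series_coef p q = series_coef q p.
Proof.
rewrite /series_coef eq_sym; case: eqVneq => [-> //|_].
rewrite (addnC q); congr (_ + _ / _); last by ring.
have -> : q%:R * p%:R * (p%:R - q%:R) = - (p%:R * q%:R * (q%:R - p%:R)) :> R by ring.
by rewrite invrN mulrN -mulNr opprB.
Qed.

Let off_diag (p q : nat) : R := let P : R := p%:R in let Q : R := q%:R in
  4 / (P ^+ 2 * Q ^+ 2) - 2 / (P * Q * (Q - P) ^+ 2) + 2 / (P * Q * (P + Q) ^+ 2).

(** The harmonic numbers cancel in pairs of consecutive indices, which leaves a
    rational function. *)
Let off_diag_identity p d : (0 < p)%N -> (0 < d)%N ->
  2 * series_coef p (p + d) - 2 * inner_coef p (p + d) + gap_coef (p + d) p =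
  off_diag p (p + d).
Proof.
move=> p0 d0; rewrite inner_coef_lt// gap_coef_lt//.
have pq : p != (p + d)%N by rewrite -{1}[p]addn0 eqn_add2l eq_sym -lt0n.
rewrite /series_coef (negPf pq) /off_diag.
have hS n : (0 < n)%N -> harm n = harm n.-1 + (n%:R)^-1.
  by case: n => // n _; rewrite harmS.
set q := (p + d)%N; have q0 : (0 < q)%N by rewrite addn_gt0 p0.
rewrite (hS p)// (hS q)// (hS d)// (hS (p + q)%N) ?addn_gt0 ?p0//.
have P0 := natr_neq0 p0; have Q0 := natr_neq0 q0; have D0 := natr_neq0 d0.
have PQ0 : p%:R + q%:R != 0 :> R by rewrite -natrD natr_neq0// addn_gt0 p0.
have Ed : d%:R = q%:R - p%:R :> R by rewrite /q natrD; ring.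
rewrite natrD Ed; rewrite Ed in D0.
move: P0 Q0 D0 PQ0; move: (p%:R) (q%:R) => P Q P0 Q0 D0 PQ0.
move: (harm p.-1) (harm q.-1) (harm d.-1) (harm (p + q).-1) => h1 h2 h3 h4.
by field; rewrite P0 Q0 D0 PQ0.
Qed.

(** The left side is the sum of 1 / (m (m + p) (m + q) (m + p + q)) over all integers m
    that are not poles. The reflection of m into - p - q - m pairs the positive m with
    those below - p - q and doubles the inner terms; the gap between - p and - q is its
    own mirror image, and at least one of the two gap coefficients is an empty sum. *)
Lemma coef_identity p q : (0 < p)%N -> (0 < q)%N ->
  2 * series_coef p q - 2 * inner_coef p q + gap_coef p q + gap_coef q p =
  double_coef p q.
Proof.
move=> p0 q0; have P0 := natr_neq0 p0; have Q0 := natr_neq0 q0.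
have PQ0 : p%:R + q%:R != 0 :> R by rewrite -natrD natr_neq0// addn_gt0 p0.
have [pq|qp|E] := ltngtP p q.
- have E : q = (p + (q - p))%N by rewrite subnKC// ltnW.
  have d0 : (0 < q - p)%N by rewrite subn_gt0.
  rewrite (gap_coef0 (ltnW pq)) addr0 [in LHS]E off_diag_identity// -E.
  have QP : q%:R - p%:R != 0 :> R by rewrite natrB_neq0// gtn_eqF.
  rewrite /off_diag /double_coef pq ltnNge (ltnW pq)/= ltn_eqF//.
  by field; rewrite P0 Q0 PQ0 QP.
- have E : p = (q + (p - q))%N by rewrite subnKC// ltnW.
  have d0 : (0 < p - q)%N by rewrite subn_gt0.
  rewrite (gap_coef0 (ltnW qp)) addr0 series_coefC inner_coefC.
  rewrite [in LHS]E off_diag_identity// -E.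
  have PQ : p%:R - q%:R != 0 :> R by rewrite natrB_neq0// gtn_eqF.
  rewrite /off_diag /double_coef qp ltnNge (ltnW qp)/= gtn_eqF//.
  by field; rewrite P0 Q0 PQ0 PQ.
rewrite -E {E q q0 Q0 PQ0} !gap_coef0// inner_coef_diag//.
rewrite /series_coef /double_coef eqxx ltnn.
have hS n : (0 < n)%N -> harm n = harm n.-1 + (n%:R)^-1.
  by case: n => // n _; rewrite harmS.
have h2S : harm2 p = harm2 p.-1 + p%:R ^- 2 by case: (p) p0 => // n _; rewrite harm2S.
rewrite (hS p)// (hS (p + p)%N) ?addn_gt0 ?p0// h2S natrD.
move: P0; move: (p%:R) (harm p.-1) (harm2 p.-1) (harm (p + p).-1) (pi : R).
by move=> P h1 h2 h3 c P0; field; rewrite P0 -mulr2n -mulr_natl mulf_neq0.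
Qed.

End Coefficients.

(** * Regrouping the zeta series *)

Section Regrouping.
Variable R : realType.
Local Notation C := R[i]^o.

Lemma cexpD (z w : C) : cexp (z + w) = cexp z * cexp w.
Proof.
case: z w => [a b] [c d]; rewrite /cexp /= expRD cosD sinD.
by apply/eqP; rewrite eq_complex /=; apply/andP; split; apply/eqP; ring.
Qed.

Lemma natpowD m (s t : C) : natpow m (s + t) = natpow m s * natpow m t.
Proof. by rewrite /natpow mulrDl cexpD. Qed.

Lemma natpow1 m : natpow m.+1 1 = m.+1%:R :> C.
Proof.
rewrite /natpow mul1r /cexp /= lnK ?posrE ?ltr0n// cos0 sin0.
by rewrite [_ +i* _](_ : _ = 1) ?mulr1 ?rmorph_nat.
Qed.

Lemma natpow_nat m n : natpow m.+1 n%:R = m.+1%:R ^+ n :> C.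
Proof.
elim: n => [|n IH].
  rewrite /natpow mul0r /cexp /= expR0 cos0 sin0 expr0.
  by rewrite [_ +i* _](_ : _ = 1) ?mulr1.
by rewrite -natr1 natpowD IH natpow1 exprSr.
Qed.

Definition weight (x y : C) (k : nat * nat) : C :=
  (natpow k.1.+1 x * natpow k.2.+1 y)^-1.

(** Evaluating a substitution gives the list of the values of its components. *)
Definition vec n (l : seq C) : 'rV[C]_n := \row_i nth 0 l i.

Lemma zeta3_vecE a b c d e f m : zeta3_term (vec 6 [:: a; b; c; d; e; f]) m =
  (natpow m.1.1.+1 a * natpow m.1.2.+1 b * natpow m.2.+1 c
   * natpow (m.1.1.+1 + m.1.2.+1) d * natpow (m.1.2.+1 + m.2.+1) e
   * natpow (m.1.1.+1 + m.1.2.+1 + m.2.+1) f)^-1.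
Proof. by rewrite /zeta3_term !mxE. Qed.

Lemma zeta2_vecE a b c m : zeta2_term (vec 3 [:: a; b; c]) m =
  (natpow m.1.+1 a * natpow m.2.+1 b * natpow (m.1.+1 + m.2.+1) c)^-1.
Proof. by rewrite /zeta2_term !mxE. Qed.

Lemma zeta_vecE a m : zeta_term (vec 1 [:: a]) m = (natpow m.+1 a)^-1.
Proof. by rewrite /zeta_term !mxE. Qed.

Implicit Types (x y l : C).

(** The coefficient attached to [p ^ -x * q ^ -y] is real and given as a function of
    the positive integers [p] and [q]. *)
Definition dirichlet2 (a : nat -> nat -> R) x y l : Prop :=
  has_sum (fun k => weight x y k * (a k.1.+1 k.2.+1)%:C : C) l.

Lemma dirichlet2_swap (a : nat -> nat -> R) x y l :
  dirichlet2 a x y l -> dirichlet2 (fun p q => a q p) y x l.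
Proof.
apply: (has_sum_inj (f := fun k => (k.2, k.1))).
- by move=> [? ?] [? ?] [-> ->].
- by move=> k; rewrite /weight/= mulrC (mulrC (natpow _ y)) mulrC.
- by move=> k nk; case: (nk (k.2, k.1)); case: k {nk}.
Qed.

(** With m1 = p and m3 = q fixed, m2 is free. *)
Lemma zeta3_series x y l :
  has_sum (zeta3_term (vec 6 [:: x; 1; y; 1; 1; 1])) l ->
  dirichlet2 (@series_coef R) x y l.
Proof.
move=> hs; apply: (has_sum_fiber (phi := fun m => (m.1.1, m.2)) hs) => -[p q].
apply: (has_sum_inj (f := fun j => (p, j, q))
  (w := fun j => weight x y (p, q) * (series_term R p.+1 q.+1 j)%:C)).
- by move=> i j [].
- move=> j; rewrite eqxx zeta3_vecE /= /weight /series_term fmorphV -invfM.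
  rewrite !addSn !natpow1 !rmorphM !rmorph_nat /=; congr (_ ^-1).
  by rewrite -!addSn !natrD; ring.
- move=> [[i j] k] nj; case: eqP => // -[E1 E2].
  by case: (nj j); rewrite -E1 -E2.
by apply: has_sumZ; apply: has_sum_ge0; [exact: series_term_ge0|exact: series_coef_cvg].
Qed.

(** With m1 + m2 = p and m2 + m3 = q fixed, m2 is any integer below both p and q. *)
Lemma zeta3_inner x y l :
  has_sum (zeta3_term (vec 6 [:: 1; 1; 1; x; y; 1])) l ->
  dirichlet2 (@inner_coef R) x y l.
Proof.
move=> hs; apply: (has_sum_fiber
  (phi := fun m => ((m.1.1 + m.1.2).+1, (m.1.2 + m.2).+1)) hs) => -[p q] /=.
pose w j := if (j < minn p q)%N then weight x y (p, q) * (inner_term R p.+1 q.+1 j)%:C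
  else 0.
apply: (has_sum_inj (f := fun j => (p - j.+1, j, q - j.+1)%N) (w := w)).
- by move=> i j [].
- move=> j; rewrite /w /= leq_min xpair_eqE.
  have [jp|pj] := ltnP j p; last first.
    rewrite [_ == p](_ : _ = false)//; apply/negP => /eqP E.
    by move: pj; rewrite -E leqNgt ltnS leq_addl.
  have [jq|qj] := ltnP j q; last first.
    rewrite [_ == q](_ : _ = false) ?andbF//; apply/negP => /eqP E.
    by move: qj; rewrite -E leqNgt ltnS leq_addr.
  have Ep : ((p - j.+1 + j).+1 = p)%N by rewrite -addnS subnK.
  have Eq : ((j + (q - j.+1)).+1 = q)%N by rewrite -addSn subnKC.
  rewrite Ep Eq !eqxx /= zeta3_vecE /= /weight /inner_term fmorphV -invfM.
  have -> : ((p - j.+1).+1 + j.+1 = p.+1)%N by lia.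
  have -> : (j.+1 + (q - j.+1).+1 = q.+1)%N by lia.
  have -> : (p.+1 + (q - j.+1).+1 = (p.+1 + q - j.+1).+1)%N.
    by lia.
  rewrite !natpow1 !rmorphM !rmorph_nat /= subSn// subSn//.
  have -> : (p.+1 + q.+1 - j.+1 = (p.+1 + q - j.+1).+1)%N.
    by lia.
  by congr (_^-1); ring.
- move=> [[a b] c] nj; case: eqP => // -[E1 E2]; case: (nj b).
  by rewrite -E1 -E2 !subSS addnK addKn.
have -> : weight x y (p, q) * (inner_coef R p.+1 q.+1)%:C = \sum_(j < minn p q) w j.
  rewrite /inner_coef minnSS /= rmorph_sum mulr_sumr; apply: eq_bigr => -[j jm] _.
  by rewrite /w /= jm.
by apply: has_sum_range => m; rewrite /w ltnNge => ->.
Qed.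

(** With m1 + m2 + m3 = p and m2 = q fixed, m1 is any integer below p - q. *)
Lemma zeta3_gap x y l :
  has_sum (zeta3_term (vec 6 [:: 1; y; 1; 1; 1; x])) l ->
  dirichlet2 (@gap_coef R) x y l.
Proof.
move=> hs; apply: (has_sum_fiber
  (phi := fun m => ((m.1.1 + m.1.2 + m.2).+2, m.1.2)) hs) => -[p q] /=.
pose w j := if (j < (p - q).-1)%N then weight x y (p, q) * (gap_term R p.+1 q.+1 j)%:C
  else 0.
apply: (has_sum_inj (f := fun j => (j, q, p - q - j.+2)%N) (w := w)).
- by move=> i j [].
- move=> j; rewrite /w /= xpair_eqE eqxx andbT.
  have [jp|pj] := ltnP j (p - q).-1; last first.
    rewrite [_ == p](_ : _ = false)//; apply/negP => /eqP E.
    move: pj; rewrite leqNgt => /negP; apply.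
    by lia.
  have jp' : (j.+2 <= p - q)%N by lia.
  have -> : ((j + q + (p - q - j.+2)).+2 == p)%N by lia.
  rewrite zeta3_vecE /= /weight /gap_term fmorphV -invfM.
  have -> : (j.+1 + q.+1 + (p - q - j.+2).+1 = p.+1)%N by lia.
  have -> : (q.+1 + (p - q - j.+2).+1 = (p.+1 - j.+2).+1)%N by lia.
  have -> : (p.+1 - q.+1 - j.+1 = (p - q - j.+2).+1)%N by lia.
  have -> : (p.+1 - j.+1 = (p.+1 - j.+2).+1)%N by lia.
  by rewrite !addSn !natpow1 !rmorphM !rmorph_nat /=; congr (_^-1);
    rewrite -!addSn !natrD; ring.
- move=> [[a b] c] nj; case: eqP => // -[E1 E2]; case: (nj a).
  by rewrite -E1 -E2; congr (_, _, _); lia.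
have -> : weight x y (p, q) * (gap_coef R p.+1 q.+1)%:C = \sum_(j < (p - q).-1) w j.
  rewrite /gap_coef subSS /= rmorph_sum mulr_sumr; apply: eq_bigr => -[j jm] _.
  by rewrite /w /= jm.
by apply: has_sum_range => m; rewrite /w ltnNge => ->.
Qed.

Lemma zeta2_sum x y l a b c :
  has_sum (zeta2_term (vec 3 [:: x + a%:R; y + b%:R; c%:R])) l ->
  dirichlet2 (fun p q => (p%:R ^+ a * q%:R ^+ b * (p%:R + q%:R) ^+ c)^-1) x y l.
Proof.
congr has_sum; apply/funext => -[p q]; rewrite zeta2_vecE /weight /= fmorphV -invfM.
rewrite !natpowD !addSn !natpow_nat !rmorphM !rmorphXn rmorphD !rmorph_nat /=.
by congr (_^-1); rewrite -addSn natrD mulrACA -!mulrA.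
Qed.

(** Here p = m1 and q = m1 + m2, so that m2 = q - p. *)
Lemma zeta2_lt x y l a b c :
  has_sum (zeta2_term (vec 3 [:: x + a%:R; c%:R; y + b%:R])) l ->
  dirichlet2 (fun p q => if (p < q)%N then
    (p%:R ^+ a * q%:R ^+ b * (q%:R - p%:R) ^+ c)^-1 else 0) x y l.
Proof.
apply: (has_sum_inj (f := fun k => (k.1, (k.1 + k.2).+1))).
- by move=> [i j] [i' j'] /= [->] /addnI ->.
- move=> [p q] /=; rewrite zeta2_vecE /weight /= !ltnS leq_addr fmorphV -invfM.
  have -> : (p + q).+2 = (p.+1 + q.+1)%N by rewrite addnS.
  have -> : (p.+1 + q.+1)%:R - p.+1%:R = q.+1%:R :> R by rewrite natrD addrC addKr.
  rewrite (addSn p) !natpowD !natpow_nat !rmorphM !rmorphXn !rmorph_nat /=.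
  by congr (_^-1); rewrite [RHS]mulrAC [X in _ = X * _]mulrACA -!mulrA.
- move=> [p q] nk /=; case: ifP => // pq; last by rewrite mulr0.
  case: (nk (p, (q - p.+1)%N)) => /=; congr (_, _).
  by rewrite -addSn subnKC.
Qed.

Lemma zeta_diag x y l n :
  has_sum (zeta_term (vec 1 [:: x + y + n%:R])) l ->
  dirichlet2 (fun p q => if p == q then p%:R ^- n else 0) x y l.
Proof.
apply: (has_sum_inj (f := fun k => (k, k))).
- by move=> i j [].
- move=> p /=; rewrite eqxx zeta_vecE /weight /= fmorphV -invfM !natpowD natpow_nat.
  by rewrite rmorphXn rmorph_nat.
- move=> [p q] nk /=; case: eqP => [[E]|_]; last by rewrite mulr0.
  by case: (nk p); rewrite E.
Qed.

End Regrouping.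

(** * The identity in the region of convergence *)

Section Values.
Variable R : realType.
Local Notation C := R[i]^o.

Lemma row_vec n m (t : n.-tuple ('rV[C]_m -> C)) w :
  \row_(i < n) tnth t i w = vec n [seq f w | f <- t].
Proof.
apply/rowP => i; rewrite !mxE (nth_map (fun=> 0)) ?size_tuple//.
by rewrite (tnth_nth (fun=> 0)).
Qed.

Lemma vec_Re n (l : seq C) : size l = n -> all (fun c => 1 <= complex.Re c) l ->
  forall i, 1 <= complex.Re (vec n l 0 i).
Proof. by move=> sl /all_nthP-/(_ 0) H i; rewrite mxE; apply: H; rewrite sl. Qed.

Lemma Re_addn (x : C) n : 1 <= complex.Re x -> 1 <= complex.Re (x + n%:R).
Proof.
rewrite -(rmorph_nat (real_complex R)); case: x => a b /= a1.
by rewrite ler_wpDr.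
Qed.

Lemma Re_natr n : 1 <= complex.Re (n.+1%:R : C).
Proof. by rewrite -(rmorph_nat (real_complex R)) /= ler1n. Qed.

Section Linearity.
Variables (x y : C).
Implicit Types (a b : nat -> nat -> R) (l m : C).

Lemma dirichlet2D a b l m : dirichlet2 a x y l -> dirichlet2 b x y m ->
  dirichlet2 (fun p q => a p q + b p q) x y (l + m).
Proof.
move=> ha hb; have := has_sumD ha hb; congr has_sum.
by apply/funext => k; rewrite -mulrDr rmorphD.
Qed.

Lemma dirichlet2Z (c : R) a l : dirichlet2 a x y l ->
  dirichlet2 (fun p q => c * a p q) x y (c%:C * l).
Proof.
move=> ha; have := has_sumZ (c := c%:C) ha; congr has_sum.
by apply/funext => k; rewrite mulrCA rmorphM.
Qed.

Lemma dirichlet2B a b l m : dirichlet2 a x y l -> dirichlet2 b x y m ->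
  dirichlet2 (fun p q => a p q - b p q) x y (l - m).
Proof.
move=> ha hb; have := dirichlet2D ha (dirichlet2Z (c := -1) hb).
rewrite rmorphN1 mulN1r.
by congr has_sum; apply/funext => k; rewrite mulN1r.
Qed.

End Linearity.

Variables (zeta : merofun R 1) (zeta2 : merofun R 3) (zeta3 : merofun R 6).
Hypotheses (hzeta : is_zeta zeta) (hzeta2 : is_zeta2 zeta2) (hzeta3 : is_zeta3 zeta3).

Lemma zeta3_vec_sum l : size l = 6%N -> all (fun c => 1 <= complex.Re c) l ->
  ~ polar zeta3 (vec 6 l) /\ has_sum (zeta3_term (vec 6 l)) (mero_val zeta3 (vec 6 l)).
Proof. by move=> sl al; apply: hzeta3.2; exact: vec_Re. Qed.

Lemma zeta2_vec_sum l : size l = 3%N -> all (fun c => 1 <= complex.Re c) l ->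
  ~ polar zeta2 (vec 3 l) /\ has_sum (zeta2_term (vec 3 l)) (mero_val zeta2 (vec 3 l)).
Proof. by move=> sl al; apply: hzeta2.2; exact: vec_Re. Qed.

Lemma zeta_vec_sum (c : C) : 1 < complex.Re c ->
  ~ polar zeta (vec 1 [:: c]) /\ has_sum (zeta_term (vec 1 [:: c])) (mero_val zeta (vec 1 [:: c])).
Proof. by move=> c1; apply: hzeta.2; rewrite /= mxE. Qed.

Variables (x y : C).
Hypotheses (x1 : 1 <= complex.Re x) (y1 : 1 <= complex.Re y).

Let Z3 a b c d e f := mero_val zeta3 (vec 6 [:: a; b; c; d; e; f]).
Let Z2 a b c := mero_val zeta2 (vec 3 [:: a; b; c]).
Let Z1 a := mero_val zeta (vec 1 [:: a]).

(** Both sides are the sum of one and the same double Dirichlet series, whose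
    coefficients are [double_coef]. *)
Lemma value_identity :
  Z3 x 1 y 1 1 1 - Z3 1 1 1 x y 1 + Z3 1 y 1 1 1 x
  + Z3 y 1 x 1 1 1 - Z3 1 1 1 y x 1 + Z3 1 x 1 1 1 y =
  2 * (Z2 (x + 2) (y + 1) 1 + Z2 (x + 2) 1 (y + 1) - Z2 (y + 1) 1 (x + 2)
     - Z2 (x + 1) 1 (y + 2) + Z2 (y + 2) 1 (x + 1) + Z2 (x + 1) (y + 2) 1
     - Z2 (x + 1) 2 (y + 1) - Z2 (y + 1) 2 (x + 1) + Z2 (x + 1) (y + 1) 2)
  + Z1 (x + y + 4) - (pi ^+ 2 / 3)%:C * Z1 (x + y + 2).
Proof.
have xn n := Re_addn n x1; have yn n := Re_addn n y1; have n1 := Re_natr.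
have z3 l : size l = 6%N -> all (fun c => 1 <= complex.Re c) l ->
  has_sum (zeta3_term (vec 6 l)) (mero_val zeta3 (vec 6 l)).
  by move=> sl al; case: (zeta3_vec_sum sl al).
have z2 l : size l = 3%N -> all (fun c => 1 <= complex.Re c) l ->
  has_sum (zeta2_term (vec 3 l)) (mero_val zeta2 (vec 3 l)).
  by move=> sl al; case: (zeta2_vec_sum sl al).
have z1 n : has_sum (zeta_term (vec 1 [:: x + y + n%:R])) (Z1 (x + y + n%:R)).
  apply: (zeta_vec_sum _).2; apply: (@lt_le_trans _ _ 2); first by rewrite ltr1n.
  rewrite -(rmorph_nat (real_complex R)).
  move: x1 y1; case: (x) (y) => [a b] [c d] /= a1 c1.
  by rewrite ler_wpDr// -[2]/(1 + 1) lerD.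
suff [l r] : dirichlet2 (double_coef R) x y
    (Z3 x 1 y 1 1 1 - Z3 1 1 1 x y 1 + Z3 1 y 1 1 1 x
     + Z3 y 1 x 1 1 1 - Z3 1 1 1 y x 1 + Z3 1 x 1 1 1 y) /\
  dirichlet2 (double_coef R) x y (2 *
    (Z2 (x + 2) (y + 1) 1 + Z2 (x + 2) 1 (y + 1) - Z2 (y + 1) 1 (x + 2)
     - Z2 (x + 1) 1 (y + 2) + Z2 (y + 2) 1 (x + 1) + Z2 (x + 1) (y + 2) 1
     - Z2 (x + 1) 2 (y + 1) - Z2 (y + 1) 2 (x + 1) + Z2 (x + 1) (y + 1) 2)
    + Z1 (x + y + 4) - (pi ^+ 2 / 3)%:C * Z1 (x + y + 2)).
  exact: has_sum_unique l r.
split.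
  have s1 : dirichlet2 (@series_coef R) x y (Z3 x 1 y 1 1 1).
    by apply: zeta3_series; apply: z3; rewrite //= ?x1 ?y1 ?lexx.
  have s2 : dirichlet2 (@inner_coef R) x y (Z3 1 1 1 x y 1).
    by apply: zeta3_inner; apply: z3; rewrite //= ?x1 ?y1 ?lexx.
  have s3 : dirichlet2 (@gap_coef R) x y (Z3 1 y 1 1 1 x).
    by apply: zeta3_gap; apply: z3; rewrite //= ?x1 ?y1 ?lexx.
  have s4 : dirichlet2 (@series_coef R) y x (Z3 y 1 x 1 1 1).
    by apply: zeta3_series; apply: z3; rewrite //= ?x1 ?y1 ?lexx.
  have s5 : dirichlet2 (@inner_coef R) y x (Z3 1 1 1 y x 1).
    by apply: zeta3_inner; apply: z3; rewrite //= ?x1 ?y1 ?lexx.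
  have s6 : dirichlet2 (@gap_coef R) y x (Z3 1 x 1 1 1 y).
    by apply: zeta3_gap; apply: z3; rewrite //= ?x1 ?y1 ?lexx.
  have := dirichlet2D (dirichlet2B (dirichlet2D (dirichlet2D (dirichlet2B s1 s2) s3)
    (dirichlet2_swap s4)) (dirichlet2_swap s5)) (dirichlet2_swap s6).
  congr has_sum; apply/funext => k /=; rewrite -coef_identity//.
  rewrite (series_coefC _ k.2.+1) (inner_coefC _ k.2.+1).
  by congr (_ * _%:C); ring.
pose sumc a b c (p q : nat) : R := (p%:R ^+ a * q%:R ^+ b * (p%:R + q%:R) ^+ c)^-1.
pose ltc a b c (p q : nat) : R := if (p < q)%N then
  (p%:R ^+ a * q%:R ^+ b * (q%:R - p%:R) ^+ c)^-1 else 0.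
pose eqc n (p q : nat) : R := if p == q then p%:R ^- n else 0.
have S a b c : (0 < c)%N -> dirichlet2 (sumc a b c) x y (Z2 (x + a%:R) (y + b%:R) c%:R).
  case: c => // c _; apply: (zeta2_sum (a := a) (b := b) (c := c.+1)).
  by apply: z2; rewrite //= xn yn n1.
have L a b c : (0 < c)%N -> dirichlet2 (ltc a b c) x y (Z2 (x + a%:R) c%:R (y + b%:R)).
  case: c => // c _; apply: (zeta2_lt (a := a) (b := b) (c := c.+1)).
  by apply: z2; rewrite //= xn yn n1.
have G a b c : (0 < c)%N ->
    dirichlet2 (fun p q => ltc a b c q p) x y (Z2 (y + a%:R) c%:R (x + b%:R)).
  case: c => // c _; apply: (dirichlet2_swap (a := ltc a b c.+1)).
  apply: (zeta2_lt (a := a) (b := b) (c := c.+1)).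
  by apply: z2; rewrite //= xn yn n1.
have E n : dirichlet2 (eqc n) x y (Z1 (x + y + n%:R)) by exact: zeta_diag (z1 n).
have := dirichlet2B (dirichlet2D (dirichlet2Z (c := 2)
  (dirichlet2D (dirichlet2B (dirichlet2B (dirichlet2D (dirichlet2D (dirichlet2B
    (dirichlet2B (dirichlet2D (S 2 1 1 isT) (L 2 1 1 isT)) (G 1 2 1 isT)) (L 1 2 1 isT))
    (G 2 1 1 isT)) (S 1 2 1 isT)) (L 1 1 2 isT)) (G 1 1 2 isT)) (S 1 1 2 isT)))
  (E 4)) (dirichlet2Z (c := pi ^+ 2 / 3) (E 2)).
by rewrite rmorph_nat.
Qed.

End Values.

(** * The functional relation *)

Section Assembly.
Variable R : realType.
Local Notation C := R[i]^o.

(** A list version, so that for explicit components it unfolds into a conjunction. *)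
Definition all_differentiable m (l : seq ('rV[C]_m -> C)) : Prop :=
  foldr (fun f P => (forall z, differentiable f z) /\ P) True l.

Lemma all_differentiable_tnth n m (t : n.-tuple ('rV[C]_m -> C)) :
  all_differentiable t -> forall i z, differentiable (tnth t i) z.
Proof.
move=> dt i z; rewrite (tnth_nth (fun=> 0)).
elim: (tval t) dt (nat_of_ord i) => [_ [|k]|f l IH [df /IH dl] [|k]] //=;
  exact: differentiable_cst.
Qed.

Lemma meromorphic_subst_vec n m (f : merofun R n) (t : n.-tuple ('rV[C]_m -> C)) w :
  all_differentiable t -> meromorphic f -> ~ polar f (vec n [seq g w | g <- t]) ->
  meromorphic (mero_subst f t).
Proof.
move=> dt mf pw; apply: (meromorphic_subst (w := w)) => //.
  exact: all_differentiable_tnth.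
by rewrite /= row_vec.
Qed.

Lemma near_Re_ge1 n : \forall w \near (const_mx 2 : 'rV[C]_n),
  forall i, 1 <= complex.Re ((w : 'rV[C]_n) 0 i).
Proof.
apply: filterS (nbhsx_ballx (const_mx 2 : 'rV[C]_n) 1 ltr01) => w [_ bw] i.
have := bw 0 i; rewrite -ball_normE /= mxE => /ltW /(@ler_Re_norm R _ 1).
rewrite -(rmorph_nat (real_complex R)); case: (w 0 i) => a b /=.
by rewrite ler_norml => /andP[_]; lra.
Qed.

End Assembly.

Theorem mainTheorem5 (R : realType) (zeta : merofun R 1) (zeta2 : merofun R 3)
    (zeta3 : merofun R 6) (hzeta : is_zeta zeta) (hzeta2 : is_zeta2 zeta2)
    (hzeta3 : is_zeta3 zeta3) :
  let s1 : 'rV[R[i]^o]_2 -> R[i]^o := coordC 0 in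
  let s3 : 'rV[R[i]^o]_2 -> R[i]^o := coordC 1 in
  (zeta3.(s1, 1, s3, 1, 1, 1) - zeta3.(1, 1, 1, s1, s3, 1)
     + zeta3.(1, s3, 1, 1, 1, s1)
     + zeta3.(s3, 1, s1, 1, 1, 1) - zeta3.(1, 1, 1, s3, s1, 1)
     + zeta3.(1, s1, 1, 1, 1, s3)
   =m 2 *: (zeta2.(s1 + 2, s3 + 1, 1) + zeta2.(s1 + 2, 1, s3 + 1)
           - zeta2.(s3 + 1, 1, s1 + 2) - zeta2.(s1 + 1, 1, s3 + 2)
           + zeta2.(s3 + 2, 1, s1 + 1) + zeta2.(s1 + 1, s3 + 2, 1)
           - zeta2.(s1 + 1, 2, s3 + 1) - zeta2.(s3 + 1, 2, s1 + 1)
           + zeta2.(s1 + 1, s3 + 1, 2))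
     + zeta.(s1 + s3 + 4)
     - (pi ^+ 2 / 3)%:C *: zeta.(s1 + s3 + 2))%mf.
Proof.
move=> s1 s3.
(* an interior point of the region of convergence of all the series *)
pose w0 : 'rV[R[i]^o]_2 := const_mx 2.
have w0E i : w0 0 i = 2 by rewrite mxE.
pose F := 'rV[R[i]^o]_2 -> R[i]^o.
have d1 z : differentiable s1 z by exact: differentiable_coord.
have d3 z : differentiable s3 z by exact: differentiable_coord.
have dc n z : differentiable (n%:R : F) z.
  have -> : (n%:R : F) = fun=> n%:R by rewrite natmulfctE.
  exact: differentiable_cst.
have dD (f : F) n : (forall z, differentiable f z) ->
    forall z, differentiable (f + n%:R) z.
  by move=> df z; apply: differentiableD.
have d13 z : differentiable (s1 + s3) z by exact: differentiableD.
have d11 := dD s1 1%N d1; have d12 := dD s1 2%N d1.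
have d31 := dD s3 1%N d3; have d32 := dD s3 2%N d3.
have d2 := dD _ 2%N d13; have d4 := dD _ 4%N d13.
have c1 := dc 1%N; have c2 := dc 2%N.
have x1 : 1 <= complex.Re (2 : R[i]^o) by exact: (Re_natr R 1).
have x1n n := Re_addn n x1; have n1 : 1 <= complex.Re (1 : R[i]^o) by [].
have m3 (t : 6.-tuple F) : all_differentiable t ->
    all (fun c => 1 <= complex.Re c) [seq g w0 | g <- t] -> meromorphic (mero_subst zeta3 t).
  move=> dt tw; apply: (meromorphic_subst_vec dt hzeta3.1 (w := w0)).
  by apply: (zeta3_vec_sum hzeta3 _ tw).1; rewrite size_map size_tuple.
have m2 (t : 3.-tuple F) : all_differentiable t ->
    all (fun c => 1 <= complex.Re c) [seq g w0 | g <- t] -> meromorphic (mero_subst zeta2 t).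
  move=> dt tw; apply: (meromorphic_subst_vec dt hzeta2.1 (w := w0)).
  by apply: (zeta2_vec_sum hzeta2 _ tw).1; rewrite size_map size_tuple.
have m1 (f : F) : (forall z, differentiable f z) -> 1 < complex.Re (f w0) ->
    meromorphic (zeta.(f))%mf.
  move=> df fw; apply: (meromorphic_subst_vec (w := w0) _ hzeta.1) => //=.
  exact: (zeta_vec_sum hzeta fw).1.
set lhs := (X in (X =m _)%mf); set rhs := (X in (_ =m X)%mf).
have mlhs : meromorphic lhs.
  by rewrite /lhs; do ?[apply: meromorphic_add | apply: meromorphic_sub]; apply: m3;
    rewrite /= /s1 /s3 /coordC ?w0E ?x1 ?n1.
have r1 n : 1 <= complex.Re ((s1 + n%:R) w0).
  by rewrite natmulfctE [X in complex.Re X](_ : _ = 2 + n%:R)// -(w0E 0).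
have r3 n : 1 <= complex.Re ((s3 + n%:R) w0).
  by rewrite natmulfctE [X in complex.Re X](_ : _ = 2 + n%:R)// -(w0E 1).
have r13 n : 1 < complex.Re ((s1 + s3 + n%:R) w0).
  rewrite natmulfctE [X in complex.Re X](_ : _ = 2 + 2 + n%:R); last first.
    by rewrite -{1}(w0E 0) -(w0E 1).
  rewrite -!natrD -(rmorph_nat (real_complex R)) /= ltr1n; lia.
have mrhs : meromorphic rhs.
  have n2 := Re_natr R 1.
  rewrite /rhs; apply: meromorphic_sub; last first.
    by apply: meromorphic_scale; apply: m1.
  apply: meromorphic_add; last by apply: m1.
  apply: meromorphic_scale.
  by do ?[apply: meromorphic_add | apply: meromorphic_sub]; apply: m2;
    rewrite /= ?(r1 1%N) ?(r1 2%N) ?(r3 1%N) ?(r3 2%N) ?n1 ?n2.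
split => // w wl wr; apply/eqP; rewrite -subr_eq0; apply/eqP.
have := meromorphic_identity (meromorphic_sub mlhs mrhs) (a := w0).
apply; last by case.
apply: filterS (near_Re_ge1 R 2) => v hv _; apply/eqP; rewrite subr_eq0; apply/eqP.
rewrite /lhs /rhs /= !row_vec.
exact: (value_identity hzeta hzeta2 hzeta3 (hv 0) (hv 1)).
Qed.
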